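(* Let $(c_n)_{n\ge0}$ be a complex sequence and put $f(z)=\sum_{n=0}^{\infty}c_nz^n$. If the series $\sum_{n=0}^{\infty}\frac{n!}{\pi^n}c_n$ is absolutely convergent, then: (a) The series $\sum_{n=1}^{\infty}c_nB_n(z+1)$ and $\sum_{n=1}^{\infty}nc_nS_{n-1}(z)$ are absolutely convergent on $\mathbb{C}$. (b) The functions $(f^{(m)})_{\sigma}(z)$, for $m=0,1,2,\ldots$, and $f_{\sigma'}(z)$ exist on $\mathbb{C}$ (i.e. the series, respectively the limit, defining them converges at every $z\in\mathbb{C}$). Moreover, the following identities hold: $$\sum_{n=0}^{\infty}c_nB_n(z+1)=(f_\sigma)'(z)=f_{\sigma'}(z)=f'_{\sigma}(z)+f_{\sigma'}(0)=\sum_{n=1}^{\infty}nc_nS_{n-1}(z)+f_{\sigma'}(0),\qquad z\in\mathbb{C}.$$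
   Context: $B_n(z)$ denotes the $n$-th Bernoulli polynomial, defined by $\frac{te^{zt}}{e^t-1}=\sum_{n=0}^\infty B_n(z)\frac{t^n}{n!}$ for $|t|<2\pi$, and $\mathfrak{b}_n:=B_n(1)$. For $n\ge 0$ and $z\in\mathbb{C}$ put $S_n(z):=\frac{B_{n+1}(z+1)-\mathfrak{b}_{n+1}}{n+1}$. For a function given by a power series $g(z)=\sum_{n=0}^\infty a_nz^n$ around $0$, its analytic summand is $g_\sigma(z):=\sum_{n=0}^\infty a_nS_n(z)$, defined wherever the series converges. For $f(z)=\sum_{n=0}^\infty c_nz^n$, $(f^{(m)})_\sigma$ is the analytic summand of the $m$-th derivative $f^{(m)}$ (expanded as a power series), $f'_\sigma:=(f')_\sigma$, $(f_\sigma)'$ is the derivative of $f_\sigma$, and $$f_{\sigma'}(z):=\lim_{N\to\infty}\sum_{n=0}^{N}c_nS_n'(z).$$ *)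

(* Defs.v *)
From Stdlib Require Export Reals Factorial.
From Coquelicot Require Export Coquelicot.

Open Scope R_scope.
Open Scope C_scope.

(** Convergence, power series and derivatives are Coquelicot's [is_series],
    [is_pseries] and [is_derive] over the field [C] ([C_NormedModule]);
    in particular [is_derive] below is the complex derivative.  The values of
    series and limits are taken with [iota] (the unique element satisfying a
    predicate, with a junk value when there is none), so existence is always
    to be stated separately. *)

Definition is_Cseries (a : nat -> C) (s : C) : Prop :=
  @is_series C_AbsRing C_NormedModule a s.

Definition is_Cpseries (a : nat -> C) (z s : C) : Prop :=
  @is_pseries C_AbsRing C_NormedModule a z s.

Definition Cseries (a : nat -> C) : C :=
  @iota C_CompleteNormedModule (is_Cseries a).

Definition Cpseries (a : nat -> C) (z : C) : C :=
  @iota C_CompleteNormedModule (is_Cpseries a z).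

Definition abs_convergent (a : nat -> C) : Prop :=
  ex_series (fun n => Cmod (a n)).

Definition Cholo_at (f : C -> C) (z : C) : Prop :=
  @ex_derive C_AbsRing C_NormedModule f z.

Definition Cexp (z : C) : C :=
  RtoC (exp (Re z)) * (cos (Im z), sin (Im z)).

Definition NtoC (n : nat) : C := RtoC (INR n).

(** [b] is the sequence [B_0(z), B_1(z), ...] of the generating function.
    The point [t = 0] is left out: the quotient has a removable singularity
    there, and [Cdiv] would give it the value [0]. *)
Definition is_bernoulli_seq (z : C) (b : nat -> C) : Prop :=
  forall t : C, t <> 0 -> (Cmod t < 2 * PI)%R ->
    is_Cpseries (fun n => b n / NtoC (fact n)) t
      (t * Cexp (z * t) / (Cexp t - 1)).

Definition bernoulli (n : nat) (z : C) : C :=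
  @iota C_CompleteNormedModule
    (fun w => exists b : nat -> C, is_bernoulli_seq z b /\ b n = w).

(** The polynomial written S_n(z) in mathematical notation. *)
Definition Spoly (n : nat) (z : C) : C :=
  (bernoulli (n + 1) (z + 1) - bernoulli (n + 1) 1) / NtoC (n + 1).

(** [is_summand g z s]: the analytic summand of [g] exists at [z] and has the
    value [s].  The coefficients [a] are those of the expansion of [g]
    around 0. *)
Definition is_summand (g : C -> C) (z s : C) : Prop :=
  exists a : nat -> C,
    @locally C_UniformSpace (RtoC 0) (fun w => is_Cpseries a w (g w)) /\
    is_Cseries (fun n => a n * Spoly n z) s.

Definition summand (g : C -> C) (z : C) : C :=
  @iota C_CompleteNormedModule (is_summand g z).

(** [f_{sigma'}] for the power series with coefficients [c].  Differentiability
    of the [S_n] is required explicitly because [C_derive] is total. *)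
Definition is_sigma_prime (c : nat -> C) (z l : C) : Prop :=
  (forall n, Cholo_at (Spoly n) z) /\
  filterlim (fun N : nat =>
      @sum_n C_AbelianMonoid (fun n => c n * C_derive (Spoly n) z) N)
    eventually (@locally C_UniformSpace l).

Definition sigma_prime (c : nat -> C) (z : C) : C :=
  @iota C_CompleteNormedModule (is_sigma_prime c z).

Definition Cderive_n (m : nat) (g : C -> C) : C -> C := Nat.iter m C_derive g.

(* Main.v *)
From Stdlib Require Import Lra Lia FunctionalExtensionality.
Require Import Defs.

(** Put [b = t / (e^t - 1) = x cot x - t / 2] with [x = i t / 2].  The Riccati
    equation of [q = 1 - x cot x] gives its Taylor coefficients a recurrence
    with nonnegative terms, and comparing derivatives shows by induction that
    the Taylor polynomials of [q] are bounded by [q] on [(0, pi)].  Hence the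
    formal solution [b] converges absolutely for [|t| < 2 pi], without any
    complex function theory, and [b (e^t - 1) = t] need only be checked
    formally.

    In particular [|B_n(0)| / n! = O(pi^-n)].  Since [B_n(z) / n!] is an Appell
    sequence, [|B_n(z)|], [|S_n(z)|] and the second-order Taylor remainders of
    [S_n] at [z] are [O(n! / pi^n)], so every series in question is dominated
    by [sum n! |c_n| / pi^n] and may be differentiated termwise.  The hypothesis
    passes from [c] to the coefficients of [f'], which settles all [f^(m)]. *)

(** * Formal power series *)

Definition shift (a : nat -> C) (n : nat) : C := a (S n).

Definition unshift (a : nat -> C) (n : nat) : C :=
  match n with O => 0 | S m => a m end.

Definition delta (n : nat) : C := match n with O => 1 | S _ => 0 end.

(** The operator [t d/dt], chosen over [d/dt] because it is diagonal on coefficients. *)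
Definition euler_op (a : nat -> C) (n : nat) : C := NtoC n * a n.

(** Cauchy product. Recursion on the index, with the first factor shifted, lets the algebraic laws
    be proved by induction generalised over [a]. *)
Fixpoint conv (a b : nat -> C) (n : nat) : C :=
  match n with
  | O => a O * b O
  | S m => a O * b (S m) + conv (shift a) b m
  end.

Lemma NtoC_S (n : nat) : NtoC (S n) = NtoC n + 1.
Proof. unfold NtoC. rewrite S_INR, RtoC_plus. reflexivity. Qed.

Lemma NtoC_neq_0 (n : nat) : (0 < n)%nat -> NtoC n <> 0.
Proof.
  intros Hn H. apply RtoC_inj in H. apply lt_0_INR in Hn. lra.
Qed.

Lemma NtoC_fact_S (n : nat) :
  NtoC (fact (S n)) = NtoC (S n) * NtoC (fact n).
Proof.
  unfold NtoC. change (fact (S n)) with (S n * fact n)%nat.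
  rewrite mult_INR, RtoC_mult. reflexivity.
Qed.

Lemma conv_ext (a a' b b' : nat -> C) (n : nat) :
  (forall k, a k = a' k) -> (forall k, b k = b' k) ->
  conv a b n = conv a' b' n.
Proof.
  intros Ha Hb.
  replace a' with a by (apply functional_extensionality; exact Ha).
  replace b' with b by (apply functional_extensionality; exact Hb).
  reflexivity.
Qed.

(** The defining equation of [conv] splits off the term with [a O]; this splits off the one with
    [b O]. Together they give commutativity and isolate both extreme terms. *)
Lemma conv_S_r (a b : nat -> C) (n : nat) :
  conv a b (S n) = conv a (shift b) n + a (S n) * b O.
Proof.
  revert a; induction n as [|n IH]; intros a.
  - reflexivity.
  - change (conv a b (S (S n)))
      with (a O * b (S (S n)) + conv (shift a) b (S n)).
    rewrite IH. cbn [conv]. unfold shift. ring.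
Qed.

Lemma conv_comm (a b : nat -> C) (n : nat) : conv a b n = conv b a n.
Proof.
  revert a; induction n as [|n IH]; intros a.
  - cbn [conv]. ring.
  - rewrite (conv_S_r b a). cbn [conv]. rewrite IH. ring.
Qed.

Lemma conv_plus_l (a a' b : nat -> C) (n : nat) :
  conv (fun k => a k + a' k) b n = conv a b n + conv a' b n.
Proof.
  revert a a'; induction n as [|n IH]; intros a a'; cbn [conv].
  - ring.
  - change (shift (fun k => a k + a' k)) with (fun k => shift a k + shift a' k).
    rewrite IH. ring.
Qed.

Lemma conv_scal_l (x : C) (a b : nat -> C) (n : nat) :
  conv (fun k => x * a k) b n = x * conv a b n.
Proof.
  revert a; induction n as [|n IH]; intros a; cbn [conv].
  - ring.
  - change (shift (fun k => x * a k)) with (fun k => x * shift a k).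
    rewrite IH. ring.
Qed.

Lemma conv_plus_r (a b b' : nat -> C) (n : nat) :
  conv a (fun k => b k + b' k) n = conv a b n + conv a b' n.
Proof. rewrite conv_comm, conv_plus_l, !(conv_comm a). reflexivity. Qed.

Lemma conv_scal_r (x : C) (a b : nat -> C) (n : nat) :
  conv a (fun k => x * b k) n = x * conv a b n.
Proof. rewrite conv_comm, conv_scal_l, (conv_comm a). reflexivity. Qed.

Lemma conv_assoc (a b c : nat -> C) (n : nat) :
  conv (conv a b) c n = conv a (conv b c) n.
Proof.
  revert a; induction n as [|n IH]; intros a.
  - cbn [conv]. ring.
  - change (conv (conv a b) c (S n))
      with (a O * b O * c (S n) + conv (shift (conv a b)) c n).
    rewrite (conv_ext (shift (conv a b))
      (fun k => a O * shift b k + conv (shift a) b k) c c) by reflexivity.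
    rewrite conv_plus_l, conv_scal_l, IH. cbn [conv]. ring.
Qed.

Lemma conv_delta_l (a : nat -> C) (n : nat) : conv delta a n = a n.
Proof.
  destruct n as [|n]; cbn [conv].
  - cbn. ring.
  - rewrite (conv_ext (shift delta) (fun k => 0 * delta k) a a).
    + rewrite conv_scal_l. cbn [delta]. ring.
    + intros k. unfold shift. cbn [delta]. ring.
    + reflexivity.
Qed.

Lemma conv_delta_r (a : nat -> C) (n : nat) : conv a delta n = a n.
Proof. rewrite conv_comm. apply conv_delta_l. Qed.

Lemma conv_unshift_l (a b : nat -> C) (n : nat) :
  conv (unshift a) b n = unshift (conv a b) n.
Proof.
  destruct n as [|n]; cbn [conv unshift].
  - ring.
  - rewrite (conv_ext (shift (unshift a)) a b b) by reflexivity. ring.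
Qed.

Lemma conv_unshift_r (a b : nat -> C) (n : nat) :
  conv a (unshift b) n = unshift (conv a b) n.
Proof.
  rewrite conv_comm, conv_unshift_l.
  destruct n as [|n]; [reflexivity | apply conv_comm].
Qed.

(** Leibniz rule. The induction rests on the fact that shifting [euler_op a] gives
    [euler_op (shift a) + shift a]. *)
Lemma euler_op_conv (a b : nat -> C) (n : nat) :
  euler_op (conv a b) n = conv (euler_op a) b n + conv a (euler_op b) n.
Proof.
  revert a; induction n as [|n IH]; intros a.
  - unfold euler_op, NtoC. cbn [conv INR]. ring.
  - cbn [conv].
    rewrite (conv_ext (shift (euler_op a))
      (fun k => euler_op (shift a) k + shift a k) b b).
    + rewrite conv_plus_l. specialize (IH (shift a)).
      unfold euler_op in IH |- * at 1. cbn [conv].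
      transitivity (NtoC (S n) * (a O * b (S n)) +
        (NtoC n * conv (shift a) b n + conv (shift a) b n)).
      * rewrite NtoC_S. ring.
      * rewrite IH. unfold euler_op. change (NtoC 0) with (RtoC 0). ring.
    + intros k. unfold shift, euler_op. rewrite NtoC_S. ring.
    + reflexivity.
Qed.

Definition exp_coef (z : C) (n : nat) : C := z ^ n / NtoC (fact n).

Lemma exp_coef_0 (z : C) : exp_coef z 0 = 1.
Proof. unfold exp_coef, NtoC. cbn. field. Qed.

Lemma exp_coef_S (z : C) (n : nat) :
  NtoC (S n) * exp_coef z (S n) = z * exp_coef z n.
Proof.
  unfold exp_coef. rewrite NtoC_fact_S, Cpow_S. field.
  split; apply NtoC_neq_0; [apply lt_O_fact | lia].
Qed.

(** Both sides have constant term 1 and solve [t y' = (z + w) t y], which determines each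
    coefficient from the preceding one. *)
Lemma exp_coef_plus (z w : C) (n : nat) :
  exp_coef (z + w) n = conv (exp_coef z) (exp_coef w) n.
Proof.
  assert (He : forall u k,
      euler_op (exp_coef u) k = u * unshift (exp_coef u) k).
  { intros u [|k]; cbn [unshift]; unfold euler_op.
    - unfold NtoC. cbn [INR]. ring.
    - apply exp_coef_S. }
  induction n as [|n IH].
  - cbn [conv]. rewrite !exp_coef_0. ring.
  - assert (H : NtoC (S n) <> 0) by (apply NtoC_neq_0; lia).
    assert (E : NtoC (S n) * exp_coef (z + w) (S n)
                = NtoC (S n) * conv (exp_coef z) (exp_coef w) (S n)).
    { rewrite exp_coef_S, IH.
      change (NtoC (S n) * conv (exp_coef z) (exp_coef w) (S n))
        with (euler_op (conv (exp_coef z) (exp_coef w)) (S n)).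
      rewrite euler_op_conv.
      rewrite (conv_ext (euler_op (exp_coef z))
        (fun k => z * unshift (exp_coef z) k) _ _ _ (He z) (fun k => eq_refl)).
      rewrite (conv_ext (exp_coef z) (exp_coef z) (euler_op (exp_coef w))
        (fun k => w * unshift (exp_coef w) k) _ (fun k => eq_refl) (He w)).
      rewrite conv_scal_l, conv_scal_r, conv_unshift_l, conv_unshift_r.
      cbn [unshift]. ring. }
    apply (f_equal (fun x => / NtoC (S n) * x)) in E.
    rewrite !Cmult_assoc, Cinv_l, !Cmult_1_l in E; assumption.
Qed.

(** * The Taylor coefficients of the cotangent *)

(** Solves the Riccati equation for the next coefficient: at [x^(n+2)], [x q' + q] contributes the
    factor [n + 3], and [x^2] contributes only when [n = 0]. *)
Definition cot_step (p : nat -> R) (n : nat) : R :=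
  (((if n =? 0 then 1 else 0) + PS_mult p p n) / INR (n + 3))%R.

(* Course-of-values recursion: [cot_table n] is final on the indices [0..n]. *)
Fixpoint cot_table (n : nat) : nat -> R :=
  match n with
  | O => fun _ => 0%R
  | S m => fun k => if k <=? m then cot_table m k else cot_step (cot_table m) m
  end.

(* [1 - x cot x = sum_n cot_coef n * x^(n+1)]; the recurrence [cot_coef_S]
   is the Riccati equation [x q' = q^2 - q + x^2] of [q = 1 - x cot x]. *)
Definition cot_coef (n : nat) : R := cot_table n n.

Lemma cot_table_coef (n k : nat) : (k <= n)%nat -> cot_table n k = cot_coef k.
Proof.
  induction n as [|n IH]; intros Hk.
  - replace k with 0%nat by lia. reflexivity.
  - destruct (Nat.eq_dec k (S n)) as [->|Hne]; [reflexivity|].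
    cbn [cot_table]. replace (k <=? n) with true
      by (symmetry; apply Nat.leb_le; lia).
    apply IH. lia.
Qed.

Lemma cot_coef_S (n : nat) :
  (INR (n + 3) * cot_coef (S n)
   = (if n =? 0 then 1 else 0) + PS_mult cot_coef cot_coef n)%R.
Proof.
  unfold cot_coef at 1. cbn [cot_table].
  replace (S n <=? n) with false by (symmetry; apply Nat.leb_gt; lia).
  unfold cot_step.
  replace (PS_mult (cot_table n) (cot_table n) n)
    with (PS_mult cot_coef cot_coef n).
  - field. apply not_0_INR. lia.
  - apply sum_eq. intros i Hi. rewrite !cot_table_coef by lia. reflexivity.
Qed.

Lemma cot_coef_ge_0 (n : nat) : (0 <= cot_coef n)%R.
Proof.
  induction n as [n IH] using (well_founded_induction Wf_nat.lt_wf).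
  destruct n as [|n]; [apply Rle_refl|].
  apply Rmult_le_reg_l with (INR (n + 3)); [apply lt_0_INR; lia|].
  rewrite Rmult_0_r, cot_coef_S.
  apply Rplus_le_le_0_compat; [destruct (n =? 0); lra|].
  apply cond_pos_sum. intros k.
  (* [cond_pos_sum] asks for the sign at every index. For [k > n] truncated subtraction produces the
     factor [cot_coef 0], which is 0. *)
  destruct (Nat.le_gt_cases k n) as [Hk|Hk].
  - apply Rmult_le_pos; apply IH; lia.
  - replace (n - k)%nat with 0%nat by lia. rewrite Rmult_0_r. apply Rle_refl.
Qed.

Lemma mono_from_derive (f df : R -> R) (a b : R) :
  (a <= b)%R ->
  (forall x, (a <= x <= b)%R -> is_derive f x (df x)) ->
  (forall x, (a <= x <= b)%R -> (0 <= df x)%R) ->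
  (f a <= f b)%R.
Proof.
  intros Hab Hd Hp.
  destruct (MVT_gen f a b df) as (c & Hc & E).
  - rewrite Rmin_left, Rmax_right by exact Hab. intros x Hx. apply Hd. lra.
  - rewrite Rmin_left, Rmax_right by exact Hab. intros x Hx.
    apply continuity_pt_filterlim.
    apply (ex_derive_continuous f). eexists. apply Hd, Hx.
  - rewrite Rmin_left, Rmax_right in Hc by exact Hab.
    assert (H := Rmult_le_pos _ (b - a) (Hp c Hc)). lra.
Qed.

Definition cot_remainder (x : R) : R := (1 - x * (cos x / sin x))%R.

Lemma cot_remainder_ge_0 (x : R) : (0 < x < PI)%R -> (0 <= cot_remainder x)%R.
Proof.
  intros Hx.
  assert (Hs := sin_gt_0 x (proj1 Hx) (proj2 Hx)).
  assert (H : (sin 0 - 0 * cos 0 <= sin x - x * cos x)%R).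
  { apply (mono_from_derive (fun x => sin x - x * cos x)%R
             (fun x => x * sin x)%R); [lra| |].
    - intros y Hy. auto_derive; [exact I|ring].
    - intros y Hy. apply Rmult_le_pos; [lra|]. apply sin_ge_0; lra. }
  rewrite sin_0 in H.
  unfold cot_remainder.
  replace (1 - x * (cos x / sin x))%R with ((sin x - x * cos x) / sin x)%R
    by (field; lra).
  apply Rmult_le_pos; [lra|]. apply Rlt_le, Rinv_0_lt_compat, Hs.
Qed.

(** In [(x q)' = x q' + q] the term [-q] of the Riccati equation cancels, which leaves a right-hand
    side increasing in [q >= 0]. *)
Lemma is_derive_cot_remainder (x : R) :
  (0 < x < PI)%R ->
  is_derive (fun x => x * cot_remainder x)%R x (x ^ 2 + cot_remainder x ^ 2)%R.
Proof.
  intros Hx.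
  assert (Hs := sin_gt_0 x (proj1 Hx) (proj2 Hx)).
  unfold cot_remainder. auto_derive; [lra|]. field. lra.
Qed.

Definition cot_poly (N : nat) (x : R) : R :=
  sum_f_R0 (fun n => cot_coef n * x ^ n)%R N.

(** The full square has further products, of total degree above [N], and all of them are
    nonnegative. The case [N = 0] is separate because [cauchy_finite] requires a positive index. *)
Lemma cot_poly_sqr (N : nat) (x : R) :
  (0 <= x)%R ->
  (sum_f_R0 (fun n => PS_mult cot_coef cot_coef n * x ^ n) N
   <= cot_poly N x ^ 2)%R.
Proof.
  intros Hx.
  destruct N as [|N]; [unfold cot_poly, PS_mult; simpl; lra|].
  assert (Hpos : forall n, (0 <= cot_coef n * x ^ n)%R).
  { intros n. apply Rmult_le_pos; [apply cot_coef_ge_0|apply pow_le, Hx]. }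
  replace (cot_poly (S N) x ^ 2)%R
    with (cot_poly (S N) x * cot_poly (S N) x)%R by ring.
  unfold cot_poly. rewrite cauchy_finite by lia.
  rewrite <- Rplus_0_r at 1. apply Rplus_le_compat.
  - apply Req_le, sum_eq. intros n Hn. unfold PS_mult. rewrite Rmult_comm, scal_sum.
    apply sum_eq. intros k Hk.
    replace (x ^ n)%R with (x ^ k * x ^ (n - k))%R.
    + ring.
    + rewrite <- pow_add. f_equal. lia.
  - apply cond_pos_sum. intros n. apply cond_pos_sum. intros k.
    apply Rmult_le_pos; apply Hpos.
Qed.

(** [x * cot_poly (S N) x] is the Taylor polynomial of [q] of degree [N + 2]. By [cot_coef_S] it
    satisfies the equation of [is_derive_cot_remainder] with the square truncated. *)
Lemma is_derive_cot_poly (N : nat) (x : R) :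
  is_derive (fun x => x * (x * cot_poly (S N) x))%R x
    (x ^ 2 + x ^ 2 * sum_f_R0 (fun n => PS_mult cot_coef cot_coef n * x ^ n) N)%R.
Proof.
  induction N as [|N IH].
  - unfold cot_poly. simpl sum_f_R0.
    assert (E := cot_coef_S 0). simpl in E. unfold PS_mult in E |- *. simpl in E |- *.
    change (cot_coef 0) with 0%R in *.
    replace (cot_coef 1) with (/ 3)%R by lra.
    auto_derive; [exact I|]. field.
  - apply (is_derive_ext
      (fun x => x * (x * cot_poly (S N) x) + cot_coef (S (S N)) * x ^ (N + 4))%R).
    + intros y. unfold cot_poly. rewrite (tech5 _ (S N)).
      replace (N + 4)%nat with (S (S (S (S N)))) by lia. simpl. ring.
    + rewrite tech5, Rmult_plus_distr_l, <- Rplus_assoc.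
      apply (is_derive_plus (K := R_AbsRing) (V := R_NormedModule)); [exact IH|].
      assert (E := cot_coef_S (S N)). simpl (S N =? 0) in E. rewrite Rplus_0_l in E.
      rewrite <- E.
      auto_derive; [exact I|].
      replace (N + 4)%nat with (S N + 3)%nat by lia.
      replace (Init.Nat.pred (S N + 3)) with (S (S (S N))) by lia.
      simpl. ring.
Qed.

(** If the inequality failed at 0, continuity would make it fail just to the right of 0. This
    handles the point 0, where [cot_remainder] divides by [sin 0] and where the generating function
    is not prescribed. *)
Lemma continuous_zero_limit_le (f : R -> R) (l b : R) :
  (0 < b)%R -> continuity_pt f 0 ->
  (forall x, (0 < x < b)%R -> (l <= f x)%R) -> (l <= f 0)%R.
Proof.
  intros Hb Hf H.
  destruct (Rle_lt_dec l (f 0)) as [|Hlt]; [assumption|exfalso].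
  destruct (Hf (l - f 0)%R) as (d & Hd & Hfd); [lra|].
  set (x := (Rmin d b / 2)%R).
  assert (Hm := Rmin_l d b). assert (Hm' := Rmin_r d b).
  assert (0 < Rmin d b)%R by (apply Rmin_glb_lt; lra).
  assert (Hx : (0 < x < b)%R) by (unfold x; lra).
  assert (Hx' := H x Hx).
  assert (Hd' : (Rabs (f x - f 0) < l - f 0)%R).
  { apply Hfd. split.
    - split; [exact I|]. lra.
    - simpl. unfold Rdist. rewrite Rminus_0_r, Rabs_pos_eq; unfold x in *; lra. }
  apply Rabs_lt_between in Hd'. lra.
Qed.

(** By [cot_poly_sqr] and the induction hypothesis, [x^2] times the truncated square is at most
    [q^2]. Comparing derivatives, [x q] minus its polynomial counterpart is nondecreasing, and it
    starts from 0. *)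
Lemma cot_poly_le (N : nat) (x : R) :
  (0 < x < PI)%R -> (x * cot_poly N x <= cot_remainder x)%R.
Proof.
  revert x; induction N as [|N IH]; intros x Hx.
  - unfold cot_poly. simpl. change (cot_coef 0) with 0%R.
    assert (H := cot_remainder_ge_0 x Hx). lra.
  - apply Rmult_le_reg_l with x; [lra|].
    set (z := fun x => (x * cot_remainder x - x * (x * cot_poly (S N) x))%R).
    (* [F 0] is [z x]. Monotonicity is used only from [e > 0], where [z x >= z e >= - e * (e *
       cot_poly (S N) e)], that is [F e >= 0]; then [e] tends to 0. *)
    set (F := fun e => (z x + e * (e * cot_poly (S N) e))%R).
    assert (H : (0 <= F 0)%R).
    { apply (continuous_zero_limit_le F 0 x); [lra| |].
      - apply continuity_pt_plus.
        + apply continuity_pt_const. intros ? ?. reflexivity.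
        + apply continuity_pt_filterlim.
          apply (ex_derive_continuous (fun x => x * (x * cot_poly (S N) x))%R).
          eexists. apply is_derive_cot_poly.
      - intros e He.
        assert (Hz : (z e <= z x)%R).
        { apply (mono_from_derive z (fun x => (x ^ 2 + cot_remainder x ^ 2) -
            (x ^ 2 + x ^ 2 * sum_f_R0
               (fun n => PS_mult cot_coef cot_coef n * x ^ n) N))%R); [lra| |].
          - intros y Hy.
            apply (is_derive_minus (K := R_AbsRing) (V := R_NormedModule)).
            + apply is_derive_cot_remainder. lra.
            + apply is_derive_cot_poly.
          - intros y Hy.
            assert (H1 := cot_poly_sqr N y ltac:(lra)).
            assert (H2 := IH y ltac:(lra)).
            assert (H3 : (0 <= y * cot_poly N y)%R).
            { apply Rmult_le_pos; [lra|]. apply cond_pos_sum. intros n.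
              apply Rmult_le_pos; [apply cot_coef_ge_0|apply pow_le; lra]. }
            assert (H4 := pow_incr _ _ 2 (conj H3 H2)).
            rewrite Rpow_mult_distr in H4.
            assert (H5 := Rmult_le_compat_l (y ^ 2) _ _ (pow2_ge_0 y) H1). lra. }
        assert (H := cot_remainder_ge_0 e ltac:(lra)).
        assert (H' := Rmult_le_pos e _ ltac:(lra) H).
        unfold F. unfold z in Hz at 1. lra. }
    unfold F, z in H. lra.
Qed.

Lemma PS_mult_S (a b : nat -> R) (n : nat) :
  PS_mult a b (S n) = (a O * b (S n) + PS_mult (fun k => a (S k)) b n)%R.
Proof.
  unfold PS_mult. rewrite decomp_sum by lia. rewrite Nat.sub_0_r. reflexivity.
Qed.

Lemma conv_RtoC (a b : nat -> R) (n : nat) :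
  conv (fun k => RtoC (a k)) (fun k => RtoC (b k)) n = RtoC (PS_mult a b n).
Proof.
  revert a; induction n as [|n IH]; intros a.
  - unfold PS_mult. simpl. symmetry. apply RtoC_mult.
  - rewrite PS_mult_S, RtoC_plus, RtoC_mult, <- IH. reflexivity.
Qed.

(** Substituting [x t] for [t] is multiplicative. This serves to change variables, to evaluate at a
    point and to insert weights [r^n] into bounds. *)
Lemma conv_pow (x : C) (a b : nat -> C) (n : nat) :
  conv (fun k => a k * x ^ k) (fun k => b k * x ^ k) n = conv a b n * x ^ n.
Proof.
  revert a; induction n as [|n IH]; intros a.
  - cbn. ring.
  - cbn [conv].
    rewrite (conv_ext (shift (fun k => a k * x ^ k))
      (fun k => x * (shift a k * x ^ k)) _ _ _
      (fun k => ltac:(unfold shift; rewrite Cpow_S; ring)) (fun k => eq_refl)).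
    rewrite conv_scal_l, IH, Cpow_S. cbn. ring.
Qed.

(** * The Bernoulli numbers *)

(* [bernoulli_coef n = B_n(0) / n!], read off from
   [t / (e^t - 1) = x cot x - t / 2] with [x = i t / 2]. *)
Definition bernoulli_coef (n : nat) : C :=
  match n with
  | O => 1
  | S m => - (RtoC (cot_coef m) * (Ci / 2) ^ (S m)) - delta m / 2
  end.

(* Euler's quadratic recurrence: [t b' = b - t b - b^2] for
   [b = t / (e^t - 1)]. *)
Lemma bernoulli_coef_euler (n : nat) :
  euler_op bernoulli_coef n
  = bernoulli_coef n - unshift bernoulli_coef n
    - conv bernoulli_coef bernoulli_coef n.
Proof.
  set (w := Ci / 2).
  assert (Hw : w ^ 2 = - / 4).
  { unfold w. cbn [Cpow]. transitivity (Ci * Ci / 4); [field|].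
    replace (Ci * Ci) with (- (1)); [field|].
    apply injective_projections; cbn; ring. }
  unfold euler_op.
  destruct n as [|[|k]]; cbn [unshift].
  - cbn. unfold NtoC. cbn. ring.
  - cbn [conv]. unfold shift. cbn [bernoulli_coef]. change (cot_coef 0) with 0%R.
    unfold NtoC. cbn. field.
  (* From index 2 on, both extreme terms carry [b_0 = 1]; once they are split off, only the tail
     [s], the series of [(b - 1) / t], is squared. *)
  - rewrite conv_S_r. cbn [conv].
    set (s := shift bernoulli_coef).
    change (bernoulli_coef (S k)) with (s k).
    change (bernoulli_coef (S (S k))) with (s (S k)).
    change (bernoulli_coef 0) with (RtoC 1).
    (* [g] is the series of [(x cot x - 1) / t] with [x = w t]. Passing from [s] to [g] completes
       the square: the term [- t b] disappears and the recurrence of [cot_coef] remains. *)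
    set (g := fun n => - (w ^ 1) * (RtoC (cot_coef n) * w ^ n)).
    assert (Hs : forall n, s n = g n + (- / 2) * delta n).
    { intros n. unfold s, shift, g. cbn [bernoulli_coef]. fold w. cbn [Cpow]. field. }
    assert (Hc : conv s s k = conv g g k - g k + delta k / 4).
    { rewrite (conv_ext _ _ _ _ k Hs Hs), conv_plus_l, !conv_plus_r.
      rewrite !conv_scal_l, !conv_scal_r, !conv_delta_l, conv_delta_r. field. }
    assert (Hg : conv g g k
      = w ^ 2 * w ^ k * RtoC (PS_mult cot_coef cot_coef k)).
    { unfold g. rewrite conv_scal_l, conv_scal_r, conv_pow, conv_RtoC.
      cbn [Cpow]. ring. }
    rewrite Hc, Hg, !Hs.
    assert (E := f_equal RtoC (cot_coef_S k)).
    rewrite RtoC_mult, RtoC_plus in E.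
    assert (HN : RtoC (INR (k + 3)) = NtoC (S (S k)) + 1).
    { rewrite <- NtoC_S. unfold NtoC. do 2 f_equal. lia. }
    rewrite HN in E.
    assert (Hd : w ^ k * RtoC (if k =? 0 then 1 else 0) = delta k).
    { destruct k; cbn; ring. }
    assert (Hgk : (NtoC (S (S k)) + 1) * g (S k)
      = - w ^ 2 * w ^ k * (RtoC (if k =? 0 then 1 else 0)
                           + RtoC (PS_mult cot_coef cot_coef k))).
    { rewrite <- E. unfold g. cbn [Cpow]. ring. }
    change (delta (S k)) with (RtoC 0).
    transitivity ((NtoC (S (S k)) + 1) * g (S k) - g (S k)); [ring|].
    rewrite Hgk, Cmult_plus_distr_l, <- Cmult_assoc, Hd, Hw. field.
Qed.

(* The coefficients of [(e^t - 1) / t]. *)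
Definition expm1_coef (n : nat) : C := / NtoC (fact (S n)).

(** Differentiating [t v = e^t - 1] gives [v + t v' = e^t = t v + 1]. *)
Lemma euler_op_expm1_coef (n : nat) :
  euler_op expm1_coef n = unshift expm1_coef n + delta n - expm1_coef n.
Proof.
  unfold euler_op, expm1_coef.
  destruct n as [|n]; cbn [unshift delta].
  - unfold NtoC. cbn. field.
  - rewrite (NtoC_fact_S (S n)), (NtoC_S (S n)). field.
    repeat split; [apply NtoC_neq_0, lt_O_fact|].
    rewrite <- NtoC_S. apply NtoC_neq_0. lia.
Qed.

Lemma conv_zero_middle (a b : nat -> C) (n : nat) :
  (forall k, (0 < k < S n)%nat -> b k = 0) ->
  conv a b (S n) = a O * b (S n) + a (S n) * b O.
Proof.
  intros H. cbn [conv]. f_equal.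
  assert (G : forall m a, (m <= n)%nat -> conv a b m = a m * b O).
  { induction m as [|m IH]; intros a' Hm; [reflexivity|].
    cbn [conv]. rewrite IH by lia. rewrite H by lia. unfold shift. ring. }
  rewrite G by lia. reflexivity.
Qed.

(* With [w = b (e^t - 1) / t], the recurrences of both factors give
   [t w' = b (1 - w)], which forces [w = 1]. *)
Lemma conv_bernoulli_expm1 (n : nat) : conv bernoulli_coef expm1_coef n = delta n.
Proof.
  set (b := bernoulli_coef). set (v := expm1_coef). set (w := conv b v).
  assert (E : forall n, euler_op w n = b n - conv b w n).
  { intros m. unfold w. rewrite euler_op_conv.
    rewrite (conv_ext (euler_op b)
      (fun k => b k + ((-1) * unshift b k + (-1) * conv b b k)) v v).
    2: { intros k. unfold b. rewrite bernoulli_coef_euler. ring. }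
    2: reflexivity.
    rewrite (conv_ext b b (euler_op v)
      (fun k => unshift v k + (delta k + (-1) * v k))).
    2: reflexivity.
    2: { intros k. unfold v. rewrite euler_op_expm1_coef. ring. }
    rewrite !conv_plus_l, !conv_plus_r, !conv_scal_l, !conv_scal_r.
    rewrite conv_unshift_l, conv_unshift_r, conv_assoc, conv_delta_r. ring. }
  induction n as [n IH] using (well_founded_induction Wf_nat.lt_wf).
  assert (H0 : w O = 1).
  { unfold w, b, v, expm1_coef, NtoC. cbn. field. }
  destruct n as [|n]; [exact H0|].
  (* Since [w O = b O = 1], the equation at [S n] reads [(n + 1) w_(n+1) = b_(n+1) - w_(n+1) -
     b_(n+1)], that is [(n + 2) w_(n+1) = 0]. *)
  specialize (E (S n)). rewrite conv_zero_middle in E.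
  2: { intros [|k] Hk; [lia|]. apply (IH (S k)). lia. }
  rewrite H0 in E. change (b O) with (RtoC 1) in E. unfold euler_op in E.
  change (w (S n) = 0).
  assert (E' : NtoC (S (S n)) * w (S n) = 0).
  { rewrite NtoC_S, Cmult_plus_distr_r, E. ring. }
  apply (f_equal (fun x => / NtoC (S (S n)) * x)) in E'.
  assert (HN : NtoC (S (S n)) <> 0) by (apply NtoC_neq_0; lia).
  rewrite Cmult_assoc, Cinv_l, Cmult_1_l, Cmult_0_r in E' by exact HN.
  exact E'.
Qed.

(** * Complex series *)

Lemma sum_n_Re_Im (a : nat -> C) (n : nat) :
  @sum_n C_AbelianMonoid a n
  = (sum_n (fun k => Re (a k)) n, sum_n (fun k => Im (a k)) n).
Proof.
  induction n as [|n IH].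
  - rewrite !sum_O. apply surjective_pairing.
  - rewrite !sum_Sn, IH. reflexivity.
Qed.

(** Balls of [C] are products of real balls. This reduces uniqueness of sums, Cauchy products and
    the exponential series to real series. *)
Lemma is_Cseries_Re_Im (a : nat -> C) (s : C) :
  is_Cseries a s <->
  is_series (fun n => Re (a n)) (Re s) /\ is_series (fun n => Im (a n)) (Im s).
Proof.
  unfold is_Cseries, is_series. split.
  - intros H. split; apply filterlim_locally; intros eps;
      specialize (proj1 (filterlim_locally _ _) H eps) as [N HN];
      exists N; intros n Hn; specialize (HN n Hn); rewrite sum_n_Re_Im in HN;
      apply HN.
  - intros [H1 H2]. apply filterlim_locally; intros eps.
    specialize (proj1 (filterlim_locally _ _) H1 eps) as [N1 HN1].
    specialize (proj1 (filterlim_locally _ _) H2 eps) as [N2 HN2].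
    exists (N1 + N2)%nat. intros n Hn. rewrite sum_n_Re_Im.
    split; [apply HN1|apply HN2]; lia.
Qed.

Lemma is_Cseries_unique (a : nat -> C) (s s' : C) :
  is_Cseries a s -> is_Cseries a s' -> s = s'.
Proof.
  rewrite !is_Cseries_Re_Im. intros [H1 H2] [H1' H2'].
  apply injective_projections.
  - apply is_series_unique in H1, H1'. unfold Re in *. congruence.
  - apply is_series_unique in H2, H2'. unfold Im in *. congruence.
Qed.

Lemma is_Cseries_ext (a b : nat -> C) (s : C) :
  (forall n, a n = b n) -> is_Cseries a s -> is_Cseries b s.
Proof. apply is_series_ext. Qed.

Lemma is_Cseries_plus (a b : nat -> C) (s t : C) :
  is_Cseries a s -> is_Cseries b t -> is_Cseries (fun n => a n + b n) (s + t).
Proof. apply (is_series_plus (K := C_AbsRing) (V := C_NormedModule)). Qed.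

Lemma is_Cseries_scal (x : C) (a : nat -> C) (s : C) :
  is_Cseries a s -> is_Cseries (fun n => x * a n) (x * s).
Proof. apply (is_series_scal (K := C_AbsRing) (V := C_NormedModule)). Qed.

Lemma is_Cseries_shift (a : nat -> C) (s : C) :
  is_Cseries (shift a) s <-> is_Cseries a (a O + s).
Proof.
  split; intros H.
  - apply (is_series_decr_1 (K := C_AbsRing) (V := C_NormedModule)).
    change (is_Cseries (shift a) (a O + s + - a O)).
    replace (a O + s + - a O) with s by ring. exact H.
  - apply (is_series_incr_1 (K := C_AbsRing) (V := C_NormedModule)).
    change (is_Cseries a (s + a O)). rewrite Cplus_comm. exact H.
Qed.

Lemma Cseries_eq (a : nat -> C) (s : C) : is_Cseries a s -> Cseries a = s.
Proof.
  intros H. apply (iota_unique (V := C_CompleteNormedModule)); [|exact H].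
  intros y Hy. exact (is_Cseries_unique a y s Hy H).
Qed.

Lemma is_Cpseries_Cpow (a : nat -> C) (z s : C) :
  is_Cpseries a z s <-> is_Cseries (fun n => a n * z ^ n) s.
Proof.
  assert (E : forall n,
    @scal C_Ring C_ModuleSpace (@pow_n C_Ring z n) (a n) = a n * z ^ n).
  { intros n. change (@pow_n C_Ring z n * a n = a n * z ^ n).
    replace (@pow_n C_Ring z n) with (z ^ n); [ring|].
    induction n as [|n IH]; [reflexivity|].
    rewrite Cpow_S, IH. reflexivity. }
  split; apply is_Cseries_ext; intros n; [|symmetry]; apply E.
Qed.

Lemma Cpseries_eq (a : nat -> C) (z s : C) :
  is_Cpseries a z s -> Cpseries a z = s.
Proof.
  intros H. apply (iota_unique (V := C_CompleteNormedModule)); [|exact H].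
  intros y Hy. apply is_Cpseries_Cpow in H, Hy.
  exact (is_Cseries_unique _ _ _ Hy H).
Qed.

Lemma abs_convergent_le (a : nat -> C) (M : nat -> R) :
  (forall n, (Cmod (a n) <= M n)%R) -> ex_series M -> abs_convergent a.
Proof.
  intros H. apply (ex_series_le (V := R_CompleteNormedModule)). intros n.
  change (Rabs (Cmod (a n)) <= M n)%R.
  rewrite Rabs_pos_eq by apply Cmod_ge_0. apply H.
Qed.

Lemma abs_convergent_is_Cseries (a : nat -> C) :
  abs_convergent a -> exists s, is_Cseries a s.
Proof.
  apply (ex_series_le (V := C_CompleteNormedModule)).
  intros n. apply Rle_refl.
Qed.

Lemma abs_convergent_Cseries (a : nat -> C) :
  abs_convergent a -> is_Cseries a (Cseries a).
Proof.
  intros H. destruct (abs_convergent_is_Cseries a H) as [s Hs].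
  rewrite (Cseries_eq a s Hs). exact Hs.
Qed.

Lemma is_Cseries_Cmod_le (a : nat -> C) (s : C) (M : nat -> R) (m : R) :
  is_Cseries a s -> (forall n, (Cmod (a n) <= M n)%R) -> is_series M m ->
  (Cmod s <= m)%R.
Proof.
  intros Ha HM Hm.
  apply (filterlim_le (F := eventually)
    (fun n => Cmod (@sum_n C_AbelianMonoid a n)) (sum_n M) (Finite (Cmod s)) (Finite m)).
  - exists O. intros n _.
    apply Rle_trans with (sum_n (fun k => Cmod (a k)) n).
    + apply (norm_sum_n_m (K := C_AbsRing) (V := C_NormedModule)).
    + apply sum_n_m_le. exact HM.
  - apply (filterlim_comp _ _ _ _ _ _ _ _ Ha).
    apply (filterlim_norm (K := C_AbsRing) (V := C_NormedModule)).
  - exact Hm.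
Qed.

Lemma ex_series_bounded (a : nat -> R) (M : R) :
  (forall n, (0 <= a n)%R) -> (forall n, (sum_f_R0 a n <= M)%R) -> ex_series a.
Proof.
  intros Ha HM.
  destruct (ex_finite_lim_seq_incr (sum_n a) M) as [l Hl].
  - intros n. rewrite sum_Sn. specialize (Ha (S n)).
    change (sum_n a n <= sum_n a n + a (S n))%R. lra.
  - intros n. rewrite sum_n_Reals. apply HM.
  - exists l. exact Hl.
Qed.

Lemma Re_Im_conv (a b : nat -> C) (n : nat) :
  conv a b n =
  ((PS_mult (fun k => Re (a k)) (fun k => Re (b k)) n
    - PS_mult (fun k => Im (a k)) (fun k => Im (b k)) n)%R,
   (PS_mult (fun k => Re (a k)) (fun k => Im (b k)) n
    + PS_mult (fun k => Im (a k)) (fun k => Re (b k)) n)%R).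
Proof.
  revert a; induction n as [|n IH]; intros a.
  - reflexivity.
  - cbn [conv]. rewrite IH, !PS_mult_S.
    apply injective_projections; cbn [fst snd Cplus Cmult]; unfold Re, Im, shift;
      cbn [fst snd Cplus Cmult]; ring.
Qed.

(** The real Cauchy product theorem is applied to the four products of real and imaginary parts,
    which inherit absolute convergence. *)
Lemma is_Cseries_conv (a b : nat -> C) (s t : C) :
  abs_convergent a -> abs_convergent b ->
  is_Cseries a s -> is_Cseries b t -> is_Cseries (conv a b) (s * t).
Proof.
  intros Ha Hb.
  assert (HRe : forall u, abs_convergent u -> ex_series (fun n => Rabs (Re (u n)))).
  { intros u. apply (ex_series_le (V := R_CompleteNormedModule)). intros n.
    change (Rabs (Rabs (Re (u n))) <= Cmod (u n))%R. rewrite Rabs_Rabsolu.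
    apply re_le_Cmod. }
  assert (HIm : forall u, abs_convergent u -> ex_series (fun n => Rabs (Im (u n)))).
  { intros u. apply (ex_series_le (V := R_CompleteNormedModule)). intros n.
    change (Rabs (Rabs (Im (u n))) <= Cmod (u n))%R. rewrite Rabs_Rabsolu.
    eapply Rle_trans; [apply Rmax_r|apply Rmax_Cmod]. }
  rewrite !is_Cseries_Re_Im. intros [Ha1 Ha2] [Hb1 Hb2].
  split.
  - apply (is_series_ext (fun n =>
      plus (PS_mult (fun k => Re (a k)) (fun k => Re (b k)) n)
       (opp (PS_mult (fun k => Im (a k)) (fun k => Im (b k)) n)))).
    + intros n. rewrite Re_Im_conv. reflexivity.
    + apply (is_series_minus (K := R_AbsRing) (V := R_NormedModule));
        apply is_series_mult; auto.
  - apply (is_series_ext (fun n =>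
      plus (PS_mult (fun k => Re (a k)) (fun k => Im (b k)) n)
       (PS_mult (fun k => Im (a k)) (fun k => Re (b k)) n))).
    + intros n. rewrite Re_Im_conv. reflexivity.
    + apply (is_series_plus (K := R_AbsRing) (V := R_NormedModule));
        apply is_series_mult; auto.
Qed.

(** The point [t = 0] is left out, to match [is_bernoulli_seq]. Equality there follows by
    continuity, and sums equal near 0 have equal coefficients. *)
Lemma pseries_coef_unique (u v : nat -> R) (r : R) (n : nat) :
  (0 < r)%R ->
  (forall t : R, t <> 0%R -> (Rabs t < r)%R ->
     exists s, is_series (fun n => u n * t ^ n)%R s /\
               is_series (fun n => v n * t ^ n)%R s) ->
  u n = v n.
Proof.
  intros Hr H.
  (* Convergence at [r / 2] bounds the terms there, so the radius is at least [r / 2]. *)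
  assert (Hcv : forall w : nat -> R,
    (exists s, is_series (fun n => w n * (r / 2) ^ n)%R s) ->
    Rbar_lt 0 (CV_radius w)).
  { intros w [s Hs].
    apply Rbar_lt_le_trans with (Finite (r / 2)); [simpl; lra|].
    apply CV_radius_bounded.
    destruct (maj_by_pos (fun n => w n * (r / 2) ^ n)%R) as (M & _ & HM).
    - exists 0%R. apply is_lim_seq_Reals.
      exact (ex_series_lim_0 _ (ex_intro _ s Hs)).
    - exists M. exact HM. }
  destruct (H (r / 2)%R) as (s & Hsu & Hsv);
    [lra|rewrite Rabs_pos_eq; lra|].
  assert (Hu : Rbar_lt 0 (CV_radius u)) by (apply Hcv; exists s; exact Hsu).
  assert (Hv : Rbar_lt 0 (CV_radius v)) by (apply Hcv; exists s; exact Hsv).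
  assert (Heq : forall t : R, t <> 0%R -> (Rabs t < r)%R ->
    PSeries u t = PSeries v t).
  { intros t Ht Htr. destruct (H t Ht Htr) as (l & Hl1 & Hl2).
    apply is_pseries_R in Hl1, Hl2. apply is_pseries_unique in Hl1, Hl2. congruence. }
  assert (Hle : forall w w' : nat -> R,
    Rbar_lt 0 (CV_radius w) -> Rbar_lt 0 (CV_radius w') ->
    (forall t : R, t <> 0%R -> (Rabs t < r)%R -> PSeries w t = PSeries w' t) ->
    (PSeries w' 0 <= PSeries w 0)%R).
  { intros w w' Hw Hw' E.
    assert (Hd : (0 <= PSeries w 0 - PSeries w' 0)%R).
    { apply (continuous_zero_limit_le (fun t => PSeries w t - PSeries w' t)%R 0 r Hr).
      - apply continuity_pt_minus; apply PSeries_continuity;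
          rewrite Rabs_R0; assumption.
      - intros x Hx. rewrite E; [lra|lra|rewrite Rabs_pos_eq; lra]. }
    lra. }
  apply PSeries_ext_recip; [assumption|assumption|].
  exists (mkposreal r Hr). intros y Hy.
  destruct (Req_dec y 0) as [->|Hy0].
  - apply Rle_antisym; apply Hle; auto.
    intros t Ht1 Ht2. symmetry. auto.
  - apply Heq; [exact Hy0|].
    change (Rabs (y - 0) < r)%R in Hy. rewrite Rminus_0_r in Hy. exact Hy.
Qed.

(** Powers of a real [t] are real, so the real and imaginary parts of the coefficients separate. *)
Lemma Cpseries_coef_unique (a b : nat -> C) (r : R) :
  (0 < r)%R ->
  (forall t : R, t <> 0%R -> (Rabs t < r)%R ->
     exists s, is_Cpseries a t s /\ is_Cpseries b t s) ->
  forall n, a n = b n.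
Proof.
  intros Hr H n.
  assert (HRe : forall (w : nat -> C) (t : R) k,
    w k * RtoC t ^ k = ((Re (w k) * t ^ k)%R, (Im (w k) * t ^ k)%R)).
  { intros w t k. rewrite <- RtoC_pow.
    apply injective_projections; cbn; unfold Re, Im; ring. }
  assert (H' : forall t : R, t <> 0%R -> (Rabs t < r)%R ->
    exists s : C,
     (is_series (fun k => Re (a k) * t ^ k)%R (Re s) /\
      is_series (fun k => Re (b k) * t ^ k)%R (Re s)) /\
     (is_series (fun k => Im (a k) * t ^ k)%R (Im s) /\
      is_series (fun k => Im (b k) * t ^ k)%R (Im s))).
  { intros t Ht Htr. destruct (H t Ht Htr) as (s & Ha & Hb). exists s.
    apply is_Cpseries_Cpow, is_Cseries_Re_Im in Ha, Hb.
    destruct Ha as [Ha1 Ha2], Hb as [Hb1 Hb2].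
    repeat split;
      [revert Ha1|revert Hb1|revert Ha2|revert Hb2]; apply is_series_ext;
      intros k; rewrite HRe; reflexivity. }
  apply injective_projections.
  - apply (pseries_coef_unique (fun k => Re (a k)) (fun k => Re (b k)) r n Hr).
    intros t Ht Htr. destruct (H' t Ht Htr) as (s & Hs & _). eauto.
  - apply (pseries_coef_unique (fun k => Im (a k)) (fun k => Im (b k)) r n Hr).
    intros t Ht Htr. destruct (H' t Ht Htr) as (s & _ & Hs). eauto.
Qed.

(** * The exponential series *)

Lemma Cmod_exp_coef (z : C) (n : nat) :
  Cmod (exp_coef z n) = (/ INR (fact n) * Cmod z ^ n)%R.
Proof.
  unfold exp_coef. rewrite Cmod_div by apply NtoC_neq_0, lt_O_fact.
  rewrite Cmod_pow. unfold NtoC. rewrite Cmod_R, Rabs_pos_eq by apply pos_INR.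
  unfold Rdiv. ring.
Qed.

Lemma is_series_exp (x : R) :
  is_series (fun n => / INR (fact n) * x ^ n)%R (exp x).
Proof. apply is_pseries_R, is_exp_Reals. Qed.

Lemma abs_convergent_exp_coef (z : C) : abs_convergent (exp_coef z).
Proof.
  eapply ex_series_ext; [intros n; symmetry; apply Cmod_exp_coef|].
  eexists. apply is_series_exp.
Qed.

Lemma Ci_pow_even (n : nat) : Ci ^ (2 * n) = RtoC ((-1) ^ n).
Proof.
  rewrite Cpow_mult_r, RtoC_pow. f_equal.
  apply injective_projections; cbn; ring.
Qed.

(** Powers of [Ci] are real at even and imaginary at odd indices. The even/odd splitting thus leads
    to the defining series of [cos] and [sin] in [y^2]. *)
Lemma is_Cseries_exp_imaginary (y : R) :
  is_Cseries (exp_coef (Ci * y)) (cos y, sin y).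
Proof.
  assert (E : forall n, exp_coef (Ci * y) n =
    ((Re (Ci ^ n) / INR (fact n) * y ^ n)%R, (Im (Ci ^ n) / INR (fact n) * y ^ n)%R)).
  { intros n. unfold exp_coef, NtoC. rewrite Cpow_mult_l, <- RtoC_pow.
    unfold Cdiv. rewrite <- RtoC_inv by apply INR_fact_neq_0.
    apply injective_projections; cbn; unfold Re, Im, Rdiv; ring. }
  assert (Hodd : forall n, Ci ^ (2 * n + 1) = (0%R, ((-1) ^ n)%R)).
  { intros n. rewrite Cpow_add_r, Ci_pow_even.
    apply injective_projections; cbn; ring. }
  (* This is the odd half of the real part and the even half of the imaginary part. *)
  assert (H0 : is_pseries (fun _ => 0%R) (y ^ 2)%R 0%R).
  { apply is_pseries_R. apply (is_series_ext (fun _ => 0%R)).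
    { intros n. change (0 = 0 * (y ^ 2) ^ n)%R. ring. }
    apply (filterlim_ext (fun _ => 0%R)); [|apply filterlim_const].
    intros n. rewrite sum_n_const. symmetry. apply Rmult_0_r. }
  assert (Hcos : is_pseries cos_n (y ^ 2)%R (cos y)).
  { unfold cos. destruct (exist_cos y²) as [l Hl].
    apply is_pseries_R, is_series_Reals. rewrite <- Rsqr_pow2. exact Hl. }
  assert (Hsin : exists l, is_pseries sin_n (y ^ 2)%R l /\ sin y = (y * l)%R).
  { unfold sin. destruct (exist_sin y²) as [l Hl]. exists l. split; [|reflexivity].
    apply is_pseries_R, is_series_Reals. rewrite <- Rsqr_pow2. exact Hl. }
  apply is_Cseries_Re_Im. split; cbn [Re Im fst snd].
  - apply (is_series_ext (fun n => Re (Ci ^ n) / INR (fact n) * y ^ n)%R).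
    { intros n. rewrite E. reflexivity. }
    apply is_pseries_R. replace (cos y) with (cos y + y * 0)%R by ring.
    apply (is_pseries_odd_even (fun n => Re (Ci ^ n) / INR (fact n))%R).
    + revert Hcos. apply is_pseries_ext. intros n. rewrite Ci_pow_even. reflexivity.
    + revert H0. apply is_pseries_ext. intros n. rewrite Hodd. symmetry. apply Rmult_0_l.
  - apply (is_series_ext (fun n => Im (Ci ^ n) / INR (fact n) * y ^ n)%R).
    { intros n. rewrite E. reflexivity. }
    destruct Hsin as (l & Hl & ->).
    apply is_pseries_R. rewrite <- (Rplus_0_l (y * l)).
    apply (is_pseries_odd_even (fun n => Im (Ci ^ n) / INR (fact n))%R).
    + revert H0. apply is_pseries_ext. intros n. rewrite Ci_pow_even. symmetry. apply Rmult_0_l.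
    + revert Hl. apply is_pseries_ext. intros n. rewrite Hodd. reflexivity.
Qed.

Lemma is_Cseries_exp (w : C) : is_Cseries (exp_coef w) (Cexp w).
Proof.
  assert (E : w = RtoC (Re w) + Ci * RtoC (Im w)).
  { destruct w. apply injective_projections; cbn; ring. }
  rewrite E at 1.
  eapply is_Cseries_ext; [intros n; symmetry; apply exp_coef_plus|].
  apply is_Cseries_conv; try apply abs_convergent_exp_coef;
    [|apply is_Cseries_exp_imaginary].
  assert (Ex : forall n, exp_coef (RtoC (Re w)) n
                         = RtoC (/ INR (fact n) * Re w ^ n)).
  { intros n. unfold exp_coef, NtoC. rewrite RtoC_mult, RtoC_inv, RtoC_pow by apply INR_fact_neq_0.
    unfold Cdiv. ring. }
  apply is_Cseries_Re_Im. split; cbn [Re Im fst snd].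
  - eapply is_series_ext; [|apply is_series_exp].
    intros n. cbv beta. rewrite Ex. reflexivity.
  - apply (filterlim_ext (fun _ => 0%R)); [|apply filterlim_const].
    intros n. rewrite (sum_n_ext _ (fun _ => 0%R)); [rewrite sum_n_const; symmetry; apply Rmult_0_r|].
    intros k. rewrite Ex. reflexivity.
Qed.

(** * Bernoulli polynomials *)

(** The terms are nonnegative, and [cot_poly_le] bounds the partial sums by [q / x]. *)
Lemma ex_series_cot_coef (x : R) :
  (0 < x < PI)%R -> ex_series (fun n => cot_coef n * x ^ n)%R.
Proof.
  intros Hx. apply ex_series_bounded with (cot_remainder x / x)%R.
  - intros n. apply Rmult_le_pos; [apply cot_coef_ge_0|apply pow_le; lra].
  - intros n. apply Rmult_le_reg_l with x; [lra|].
    replace (x * (cot_remainder x / x))%R with (cot_remainder x) by (field; lra).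
    apply (cot_poly_le n x Hx).
Qed.

Lemma Cmod_delta (n : nat) : Cmod (delta n) = (0 ^ n)%R.
Proof.
  destruct n; cbn [delta].
  - apply Cmod_1.
  - rewrite Cmod_0. simpl. ring.
Qed.

(** Since [|i t / 2| = |t| / 2 = x < pi], the cotangent series at [x] dominates. The [delta] term is
    covered by a geometric series of ratio 0. *)
Lemma abs_convergent_bernoulli_coef (t : C) :
  t <> 0 -> (Cmod t < 2 * PI)%R ->
  abs_convergent (fun n => bernoulli_coef n * t ^ n).
Proof.
  intros Ht Htp. apply Cmod_gt_0 in Ht.
  set (x := (Cmod t / 2)%R). assert (Hx : (0 < x < PI)%R) by (unfold x; lra).
  apply (ex_series_incr_1 (K := R_AbsRing) (V := R_NormedModule)).
  apply (ex_series_le (V := R_CompleteNormedModule)) with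
    (fun n => x * (cot_coef n * x ^ n) + x * (0 ^ n))%R.
  - intros n. change (Rabs (Cmod (bernoulli_coef (S n) * t ^ S n))
      <= x * (cot_coef n * x ^ n) + x * (0 ^ n))%R.
    rewrite Rabs_pos_eq by apply Cmod_ge_0. cbn [bernoulli_coef].
    assert (Hp := cot_coef_ge_0 n).
    replace ((- (RtoC (cot_coef n) * (Ci / 2) ^ S n) - delta n / 2) * t ^ S n)
      with (- (RtoC (cot_coef n) * (Ci / 2 * t) ^ S n)
            + - (t / 2) * (delta n * t ^ n))
      by (rewrite Cpow_mult_l, !Cpow_S; field).
    assert (H2 : Cmod 2 = 2%R) by (rewrite Cmod_R, Rabs_pos_eq; lra).
    assert (H2' : RtoC 2 <> 0) by (intros H; apply RtoC_inj in H; lra).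
    eapply Rle_trans; [apply Cmod_triangle|]. apply Rplus_le_compat.
    + rewrite Cmod_opp, Cmod_mult, Cmod_pow, Cmod_mult, Cmod_div by exact H2'.
      rewrite Cmod_R, Rabs_pos_eq, Cmod_Ci, H2 by exact Hp.
      replace (1 / 2 * Cmod t)%R with x by (unfold x; field).
      apply Req_le. simpl. ring.
    + rewrite Cmod_mult, Cmod_opp, Cmod_div, H2 by exact H2'. fold x.
      apply Rmult_le_compat_l; [lra|].
      rewrite Cmod_mult, Cmod_delta. destruct n; simpl.
      * rewrite Cmod_1. lra.
      * lra.
  - apply (ex_series_plus (K := R_AbsRing) (V := R_NormedModule));
      apply (ex_series_scal (K := R_AbsRing) (V := R_NormedModule)).
    + apply ex_series_cot_coef, Hx.
    + apply ex_series_geom. rewrite Rabs_R0. lra.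
Qed.

Lemma exp_coef_mult (z t : C) (n : nat) :
  exp_coef (z * t) n = exp_coef z n * t ^ n.
Proof. unfold exp_coef, Cdiv. rewrite Cpow_mult_l. ring. Qed.

(** The coefficient of [t^n] in [b(t) e^(z t)]. With [bernoulli_coef] it is [B_n(z) / n!], with
    [delta] it is [z^n / n!]. *)
Definition appell (b : nat -> C) (n : nat) (z : C) : C := conv b (exp_coef z) n.

Lemma bernoulli_genfun (z t : C) :
  t <> 0 -> (Cmod t < 2 * PI)%R ->
  is_Cseries (fun n => appell bernoulli_coef n z * t ^ n)
    (t * Cexp (z * t) / (Cexp t - 1)).
Proof.
  intros Ht Htp.
  assert (HB := abs_convergent_bernoulli_coef t Ht Htp).
  assert (HB' := abs_convergent_Cseries _ HB).
  set (B := Cseries (fun n => bernoulli_coef n * t ^ n)) in HB'.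
  assert (Hexpm1 : forall n, expm1_coef n * t ^ n = / t * shift (exp_coef t) n).
  { intros n. unfold expm1_coef, shift, exp_coef. rewrite Cpow_S. field.
    split; [apply NtoC_neq_0, lt_O_fact|exact Ht]. }
  assert (HV : is_Cseries (fun n => expm1_coef n * t ^ n) (/ t * (Cexp t - 1))).
  { eapply is_Cseries_ext; [intros n; symmetry; apply Hexpm1|].
    apply is_Cseries_scal, is_Cseries_shift. rewrite exp_coef_0.
    replace (1 + (Cexp t - 1)) with (Cexp t) by ring. apply is_Cseries_exp. }
  assert (HVa : abs_convergent (fun n => expm1_coef n * t ^ n)).
  { apply abs_convergent_le with (fun n => Cmod (/ t) * Cmod (exp_coef t (S n)))%R.
    - intros n. rewrite Hexpm1, Cmod_mult. apply Rle_refl.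
    - apply (ex_series_scal (K := R_AbsRing) (V := R_NormedModule)).
      apply (ex_series_incr_1 (K := R_AbsRing) (V := R_NormedModule)
        (fun n => Cmod (exp_coef t n))).
      apply abs_convergent_exp_coef. }
  (* The formal identity [conv_bernoulli_expm1], evaluated at [t] by a Cauchy product. *)
  assert (E : B * (/ t * (Cexp t - 1)) = 1).
  { apply (is_Cseries_unique delta).
    - eapply is_Cseries_ext; [|exact (is_Cseries_conv _ _ _ _ HB HVa HB' HV)].
      intros n. cbv beta. rewrite conv_pow, conv_bernoulli_expm1.
      destruct n; cbn; ring.
    - apply is_Cseries_ext with (fun n => 0 ^ n * / NtoC (fact n)).
      + intros [|n]; [unfold NtoC; cbn; field|]. cbn [delta]. rewrite Cpow_S. ring.
      + replace (RtoC 1) with (Cexp 0) by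
          (unfold Cexp; cbn; rewrite exp_0, cos_0, sin_0;
           apply injective_projections; cbn; ring).
        apply is_Cseries_exp. }
  (* A product equal to 1 has no zero factor, so [e^t] differs from 1 in the punctured disc. *)
  assert (Hne : Cexp t - 1 <> 0).
  { intros H. rewrite H, !Cmult_0_r in E. apply RtoC_inj in E. lra. }
  replace (t * Cexp (z * t) / (Cexp t - 1)) with (B * Cexp (z * t)).
  - eapply is_Cseries_ext;
      [|exact (is_Cseries_conv _ _ _ _ HB (abs_convergent_exp_coef (z * t))
                 HB' (is_Cseries_exp (z * t)))].
    intros n. unfold appell. rewrite <- conv_pow.
    apply conv_ext; [reflexivity|apply exp_coef_mult].
  - transitivity (B * (/ t * (Cexp t - 1)) * (t * Cexp (z * t) / (Cexp t - 1))).
    + field. split; assumption.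
    + rewrite E. ring.
Qed.

(** Resolves the [iota] in [bernoulli]: [bernoulli_genfun] supplies a sequence, and
    [Cpseries_coef_unique] on real [t] shows that it is the only one. *)
Lemma bernoulli_appell (n : nat) (z : C) :
  bernoulli n z = NtoC (fact n) * appell bernoulli_coef n z.
Proof.
  assert (Hfact : forall k, NtoC (fact k) <> 0)
    by (intros k; apply NtoC_neq_0, lt_O_fact).
  apply (iota_unique (V := C_CompleteNormedModule)).
  - intros w (b & Hb & <-).
    assert (H : b n / NtoC (fact n) = appell bernoulli_coef n z).
    { apply (Cpseries_coef_unique (fun k => b k / NtoC (fact k))
        (fun k => appell bernoulli_coef k z) (2 * PI)).
      - assert (H := PI_RGT_0). lra.
      - intros t Ht Htp.
        assert (Ht' : RtoC t <> 0) by (intros E; apply RtoC_inj in E; auto).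
        assert (Htp' : (Cmod t < 2 * PI)%R) by (rewrite Cmod_R; exact Htp).
        eexists. split.
        + apply Hb; assumption.
        + apply is_Cpseries_Cpow, bernoulli_genfun; assumption. }
    rewrite <- H. change (b n = NtoC (fact n) * (b n / NtoC (fact n))).
    field. apply Hfact.
  - exists (fun k => NtoC (fact k) * appell bernoulli_coef k z).
    split; [|reflexivity].
    intros t Ht Htp. apply is_Cpseries_Cpow.
    eapply is_Cseries_ext; [|exact (bernoulli_genfun z t Ht Htp)].
    intros k. cbv beta. field. apply Hfact.
Qed.

(** * Appell sequences *)

Lemma appell_plus (b : nat -> C) (n : nat) (z h : C) :
  appell b n (z + h) = conv (fun k => appell b k z) (exp_coef h) n.
Proof.
  unfold appell. rewrite (conv_ext b b (exp_coef (z + h))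
    (conv (exp_coef z) (exp_coef h))).
  - symmetry. apply conv_assoc.
  - reflexivity.
  - apply exp_coef_plus.
Qed.

Lemma Cmod_conv_le (p q : nat -> C) (K : R) (n : nat) :
  (forall k, (Cmod (p k) <= K)%R) ->
  (Cmod (conv p q n) <= K * sum_f_R0 (fun k => Cmod (q k)) n)%R.
Proof.
  intros Hp. rewrite conv_comm. revert q; induction n as [|n IH]; intros q.
  - simpl. rewrite Cmod_mult, Rmult_comm.
    apply Rmult_le_compat_r; [apply Cmod_ge_0|apply Hp].
  - cbn [conv]. rewrite decomp_sum by lia. rewrite Rmult_plus_distr_l.
    eapply Rle_trans; [apply Cmod_triangle|]. apply Rplus_le_compat.
    + rewrite Cmod_mult, Rmult_comm.
      apply Rmult_le_compat_r; [apply Cmod_ge_0|apply Hp].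
    + apply (IH (shift q)).
Qed.

Lemma sum_exp_le (x : R) (n : nat) :
  (0 <= x)%R -> (sum_f_R0 (fun k => / INR (fact k) * x ^ k) n <= exp x)%R.
Proof.
  intros Hx. apply sum_incr.
  - apply is_lim_seq_Reals.
    apply is_lim_seq_ext with (sum_n (fun k => / INR (fact k) * x ^ k)%R).
    + intros k. apply sum_n_Reals.
    + apply is_series_exp.
  - intros k. apply Rmult_le_pos; [|apply pow_le, Hx].
    apply Rlt_le, Rinv_0_lt_compat, INR_fact_lt_0.
Qed.

(** The weights [r^n] are moved into both factors by [conv_pow]; the second one then sums to at most
    [M * exp (r * |h|)]. In the Taylor estimate [M] is [|h|^2]. *)
Lemma Cmod_conv_exp_le (p q : nat -> C) (h : C) (r K M : R) (n : nat) :
  (0 < r)%R -> (0 <= M)%R ->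
  (forall k, (Cmod (p k) * r ^ k <= K)%R) ->
  (forall k, (Cmod (q k) <= M * Cmod (exp_coef h k))%R) ->
  (Cmod (conv p q n) * r ^ n <= K * (M * exp (r * Cmod h)))%R.
Proof.
  intros Hr HM Hp Hq.
  assert (Hpow : forall (x : C) k, (Cmod x * r ^ k)%R = Cmod (x * RtoC r ^ k)).
  { intros x k. rewrite Cmod_mult, Cmod_pow, Cmod_R, Rabs_pos_eq by lra.
    reflexivity. }
  assert (HK : (0 <= K)%R).
  { eapply Rle_trans; [|apply (Hp O)]. rewrite Hpow. apply Cmod_ge_0. }
  rewrite Hpow, <- conv_pow.
  eapply Rle_trans; [apply Cmod_conv_le with (K := K)|].
  - intros k. rewrite <- Hpow. apply Hp.
  - apply Rmult_le_compat_l; [exact HK|].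
    apply Rle_trans with
      (M * sum_f_R0 (fun k => / INR (fact k) * (r * Cmod h) ^ k) n)%R.
    + rewrite scal_sum. apply sum_Rle. intros k _. rewrite <- Hpow.
      apply Rle_trans with (M * Cmod (exp_coef h k) * r ^ k)%R.
      * apply Rmult_le_compat_r; [apply pow_le; lra|apply Hq].
      * rewrite Cmod_exp_coef, Rpow_mult_distr. apply Req_le. ring.
    + apply Rmult_le_compat_l; [exact HM|]. apply sum_exp_le.
      apply Rmult_le_pos; [lra|apply Cmod_ge_0].
Qed.

Lemma Cmod_appell_le (b : nat -> C) (r K : R) (n : nat) (z : C) :
  (0 < r)%R -> (forall k, (Cmod (b k) * r ^ k <= K)%R) ->
  (Cmod (appell b n z) * r ^ n <= K * exp (r * Cmod z))%R.
Proof.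
  intros Hr Hb. rewrite <- (Rmult_1_l (exp _)).
  apply Cmod_conv_exp_le; [exact Hr|lra|exact Hb|intros k; lra].
Qed.

(** [unshift] encodes the Appell rule: the derivative of each member is the previous one. Removing
    degrees 0 and 1 from [e^(h t)] leaves its double shift, bounded by [|h|^2] times the exponential
    terms since [1 / (k+2)! <= 1 / k!]. The factor [r^2] makes up for the two lost indices. *)
Lemma appell_taylor (b : nat -> C) (r K : R) (n : nat) (z h : C) :
  (0 < r)%R -> (forall k, (Cmod (b k) * r ^ k <= K)%R) ->
  (Cmod h <= 1)%R ->
  (Cmod (appell b n (z + h) - appell b n z
         - h * unshift (fun k => appell b k z) n) * r ^ n
   <= K * exp (r * Cmod z) * exp r * r ^ 2 * Cmod h ^ 2)%R.
Proof.
  intros Hr Hb Hh.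
  set (p := fun k => appell b k z).
  assert (Hp : forall k, (Cmod (p k) * r ^ k <= K * exp (r * Cmod z))%R)
    by (intros k; apply Cmod_appell_le; assumption).
  assert (HK : (0 <= K * exp (r * Cmod z))%R).
  { eapply Rle_trans; [|apply (Hp O)].
    apply Rmult_le_pos; [apply Cmod_ge_0|apply pow_le; lra]. }
  assert (Hpos : (0 <= K * exp (r * Cmod z) * exp r * r ^ 2 * Cmod h ^ 2)%R).
  { apply Rmult_le_pos; [|apply pow2_ge_0].
    apply Rmult_le_pos; [|apply pow2_ge_0].
    apply Rmult_le_pos; [exact HK|apply Rlt_le, exp_pos]. }
  rewrite appell_plus. fold p. change (appell b n z) with (p n).
  assert (H1 : exp_coef h 1 = h).
  { unfold exp_coef, NtoC. cbn. field. }
  (* The remainder is zero for [n = 0] and [n = 1]. *)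
  destruct n as [|[|m]]; cbn [unshift].
  - cbn [conv]. rewrite exp_coef_0.
    replace (p O * 1 - p O - h * 0) with (RtoC 0) by ring.
    rewrite Cmod_0, Rmult_0_l. exact Hpos.
  - cbn [conv]. unfold shift. rewrite exp_coef_0, H1.
    replace (p O * h + p 1%nat * 1 - p 1%nat - h * p O) with (RtoC 0) by ring.
    rewrite Cmod_0, Rmult_0_l. exact Hpos.
  - rewrite !conv_S_r. change (shift (exp_coef h) 0) with (exp_coef h 1).
    rewrite exp_coef_0, H1.
    set (q := shift (shift (exp_coef h))).
    replace (conv p q m + p (S m) * h + p (S (S m)) * 1 - p (S (S m)) - h * p (S m))
      with (conv p q m) by ring.
    assert (Hq : forall k, (Cmod (q k) <= Cmod h ^ 2 * Cmod (exp_coef h k))%R).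
    { intros k. unfold q, shift. rewrite !Cmod_exp_coef.
      replace (Cmod h ^ S (S k))%R with (Cmod h ^ 2 * Cmod h ^ k)%R by (simpl; ring).
      rewrite <- Rmult_assoc, (Rmult_comm _ (Cmod h ^ 2)), Rmult_assoc.
      apply Rmult_le_compat_l; [apply pow2_ge_0|].
      apply Rmult_le_compat_r; [apply pow_le, Cmod_ge_0|].
      apply Rinv_le_contravar; [apply INR_fact_lt_0|].
      apply le_INR, fact_le. lia. }
    assert (H := Cmod_conv_exp_le p q h r _ (Cmod h ^ 2) m Hr (pow2_ge_0 _) Hp Hq).
    apply Rle_trans with
      (K * exp (r * Cmod z) * (Cmod h ^ 2 * exp (r * Cmod h)) * r ^ 2)%R.
    + replace (r ^ S (S m))%R with (r ^ m * r ^ 2)%R by (simpl; ring).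
      rewrite <- Rmult_assoc. apply Rmult_le_compat_r; [apply pow2_ge_0|exact H].
    (* Here [|h| <= 1] makes the constant independent of [h]. *)
    + assert (He : (exp (r * Cmod h) <= exp r)%R).
      { apply Rnot_lt_le. intros Hlt. apply exp_lt_inv in Hlt.
        assert (H' := Rmult_le_compat_l r _ _ (Rlt_le _ _ Hr) Hh). lra. }
      replace (K * exp (r * Cmod z) * exp r * r ^ 2 * Cmod h ^ 2)%R
        with (K * exp (r * Cmod z) * (Cmod h ^ 2 * exp r) * r ^ 2)%R by ring.
      apply Rmult_le_compat_r; [apply pow2_ge_0|].
      apply Rmult_le_compat_l; [exact HK|].
      apply Rmult_le_compat_l; [apply pow2_ge_0|exact He].
Qed.

(** * Complex derivatives *)

Lemma is_derive_quadratic (f : C -> C) (z l : C) (M : R) :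
  (forall h, (Cmod h <= 1)%R ->
     (Cmod (f (z + h)%C - f z - h * l) <= M * Cmod h ^ 2)%R) ->
  @is_derive C_AbsRing C_NormedModule f z l.
Proof.
  intros H. split; [apply is_linear_scal_l|].
  intros x Hx.
  (* The differentiability predicate quantifies over all limits of the neighbourhood filter of [z];
     the only one is [z]. *)
  apply (is_filter_lim_locally_unique (V := AbsRing_NormedModule C_AbsRing)) in Hx.
  subst x.
  intros eps.
  assert (HM : (0 <= Rabs M)%R) by apply Rabs_pos.
  assert (Heps := cond_pos eps).
  assert (Hd : (0 < Rmin 1 (eps / (Rabs M + 1)))%R).
  { apply Rmin_glb_lt; [lra|]. apply Rdiv_lt_0_compat; lra. }
  exists (mkposreal _ Hd). intros y Hy.
  change (Cmod (y - z) < Rmin 1 (eps / (Rabs M + 1)))%R in Hy.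
  change (Cmod (f y - f z - (y - z) * l) <= eps * Cmod (y - z))%R.
  assert (Hy1 := Rlt_le_trans _ _ _ Hy (Rmin_l _ _)).
  assert (Hy2 := Rlt_le_trans _ _ _ Hy (Rmin_r _ _)).
  set (h := y - z) in *. replace y with (z + h) by (unfold h; ring).
  eapply Rle_trans; [apply H; lra|].
  assert (Hh := Cmod_ge_0 h).
  replace (M * Cmod h ^ 2)%R with (M * Cmod h * Cmod h)%R by ring.
  apply Rmult_le_compat_r; [exact Hh|].
  apply Rle_trans with ((Rabs M + 1) * Cmod h)%R.
  - apply Rmult_le_compat_r; [exact Hh|]. assert (H' := Rle_abs M). lra.
  - apply (Rmult_lt_compat_l (Rabs M + 1)), Rlt_le in Hy2; [|lra].
    replace ((Rabs M + 1) * (eps / (Rabs M + 1)))%R with (pos eps) in Hy2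
      by (field; lra).
    exact Hy2.
Qed.

(** Summing the termwise remainders bounds the remainder of the sum by [m * |h|^2], so
    [is_derive_quadratic] applies. *)
Lemma is_derive_Cseries (u : nat -> C -> C) (u' : nat -> C) (z l : C) (M : nat -> R) :
  ex_series M ->
  (forall n h, (Cmod h <= 1)%R ->
     (Cmod (u n (z + h)%C - u n z - h * u' n) <= M n * Cmod h ^ 2)%R) ->
  (forall w, abs_convergent (fun n => u n w)) ->
  is_Cseries u' l ->
  @is_derive C_AbsRing C_NormedModule (fun w => Cseries (fun n => u n w)) z l.
Proof.
  intros [m Hm] Hu Ha Hl.
  apply is_derive_quadratic with m. intros h Hh.
  assert (Hs := fun w => abs_convergent_Cseries _ (Ha w)).
  set (F := fun w => Cseries (fun n => u n w)) in *.
  assert (HS : is_Cseries (fun n => u n (z + h) + (-1) * u n z + (- h) * u' n)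
                 (F (z + h) + (-1) * F z + (- h) * l)).
  { apply is_Cseries_plus; [apply is_Cseries_plus|];
      [apply Hs|apply is_Cseries_scal, Hs|apply is_Cseries_scal, Hl]. }
  change (Cmod (F (z + h)%C - F z - h * l) <= m * Cmod h ^ 2)%R.
  replace (F (z + h) - F z - h * l) with (F (z + h) + (-1) * F z + (- h) * l) by ring.
  apply (is_Cseries_Cmod_le _ _ (fun n => M n * Cmod h ^ 2)%R _ HS).
  - intros n.
    replace (u n (z + h) + -1 * u n z + - h * u' n)
      with (u n (z + h) - u n z - h * u' n) by ring.
    apply Hu, Hh.
  - apply is_series_scal_r, Hm.
Qed.

(** * Series with weight [n! / pi^n] *)

Definition growth (n : nat) : R := (INR (fact n) / PI ^ n)%R.

Definition growth_summable (c : nat -> C) : Prop :=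
  abs_convergent (fun n => NtoC (fact n) / (RtoC PI ^ n) * c n).

Lemma growth_gt_0 (n : nat) : (0 < growth n)%R.
Proof.
  apply Rdiv_lt_0_compat; [apply INR_fact_lt_0|apply pow_lt, PI_RGT_0].
Qed.

Lemma growth_S (n : nat) : growth (S n) = (INR (S n) * growth n / PI)%R.
Proof.
  unfold growth. change (fact (S n)) with (S n * fact n)%nat.
  rewrite mult_INR. assert (H := PI_RGT_0).
  assert (H' := pow_lt PI n H). simpl pow. field. lra.
Qed.

Lemma Cmod_growth (n : nat) (x : C) :
  Cmod (NtoC (fact n) / (RtoC PI ^ n) * x) = (growth n * Cmod x)%R.
Proof.
  assert (H := PI_RGT_0).
  rewrite Cmod_mult, Cmod_div
    by (apply Cpow_nz; intros E; apply RtoC_inj in E; lra).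
  unfold NtoC, growth. rewrite Cmod_pow, !Cmod_R, !Rabs_pos_eq;
    [reflexivity|lra|apply pos_INR].
Qed.

Lemma growth_summable_ex_series (c : nat -> C) (D : R) :
  growth_summable c -> ex_series (fun n => growth n * Cmod (c n) * D)%R.
Proof.
  intros Hc. apply ex_series_scal_r.
  eapply ex_series_ext; [|exact Hc]. intros n. apply Cmod_growth.
Qed.

Lemma growth_summable_mult (c x : nat -> C) (D : R) :
  growth_summable c -> (forall n, (Cmod (x n) <= growth n * D)%R) ->
  abs_convergent (fun n => c n * x n).
Proof.
  intros Hc Hx. eapply abs_convergent_le;
    [|exact (growth_summable_ex_series c D Hc)].
  intros n. cbv beta. rewrite Cmod_mult.
  replace (growth n * Cmod (c n) * D)%R with (Cmod (c n) * (growth n * D))%R by ring.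
  apply Rmult_le_compat_l; [apply Cmod_ge_0|apply Hx].
Qed.

Lemma is_derive_growth_series (c : nat -> C) (u : nat -> C -> C) (u' : nat -> C)
    (z l : C) (D : R) :
  growth_summable c ->
  (forall w, exists B, forall n, (Cmod (u n w) <= growth n * B)%R) ->
  (forall n h, (Cmod h <= 1)%R ->
     (Cmod (u n (z + h)%C - u n z - h * u' n) <= growth n * (D * Cmod h ^ 2))%R) ->
  is_Cseries (fun n => c n * u' n) l ->
  @is_derive C_AbsRing C_NormedModule
    (fun w => Cseries (fun n => c n * u n w)) z l.
Proof.
  intros Hc Hb Hu Hl.
  apply (is_derive_Cseries (fun n w => c n * u n w) (fun n => c n * u' n) z l
    (fun n => growth n * Cmod (c n) * D)%R); [| | |exact Hl].
  - apply growth_summable_ex_series, Hc.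
  - intros n h Hh.
    replace (c n * u n (z + h) - c n * u n z - h * (c n * u' n))
      with (c n * (u n (z + h) - u n z - h * u' n)) by ring.
    rewrite Cmod_mult.
    replace (growth n * Cmod (c n) * D * Cmod h ^ 2)%R
      with (Cmod (c n) * (growth n * (D * Cmod h ^ 2)))%R by ring.
    apply Rmult_le_compat_l; [apply Cmod_ge_0|apply Hu, Hh].
  - intros w. destruct (Hb w) as [B HB].
    exact (growth_summable_mult c (fun n => u n w) B Hc HB).
Qed.

Definition deriv_coef (c : nat -> C) (n : nat) : C := NtoC (n + 1) * c (n + 1)%nat.

(** The identity [n! (n+1) / pi^n = pi * (n+1)! / pi^(n+1)] makes the new series [pi] times the tail
    of the old one. *)
Lemma growth_summable_deriv (c : nat -> C) :
  growth_summable c -> growth_summable (deriv_coef c).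
Proof.
  intros Hc.
  apply (ex_series_ext (fun n => scal PI
    (Cmod (NtoC (fact (S n)) / (RtoC PI ^ S n) * c (S n))))).
  - intros n. rewrite !Cmod_growth. unfold deriv_coef. rewrite Nat.add_1_r.
    rewrite growth_S, Cmod_mult. unfold NtoC.
    rewrite Cmod_R, Rabs_pos_eq by apply pos_INR.
    change (PI * (INR (S n) * growth n / PI * Cmod (c (S n)))
            = growth n * (INR (S n) * Cmod (c (S n))))%R.
    field. assert (H := PI_RGT_0). lra.
  - apply (ex_series_scal (K := R_AbsRing) (V := R_NormedModule)).
    apply (ex_series_incr_1 (K := R_AbsRing) (V := R_NormedModule)
      (fun n => Cmod (NtoC (fact n) / (RtoC PI ^ n) * c n))).
    exact Hc.
Qed.

Lemma Cmod_fact_mult_le (n : nat) (x : C) (D : R) :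
  (Cmod x * PI ^ n <= D)%R -> (Cmod (NtoC (fact n) * x) <= growth n * D)%R.
Proof.
  intros Hx. assert (Hp := pow_lt PI n PI_RGT_0).
  replace (Cmod (NtoC (fact n) * x)) with (growth n * (Cmod x * PI ^ n))%R.
  - apply Rmult_le_compat_l; [apply Rlt_le, growth_gt_0|exact Hx].
  - unfold growth, NtoC. rewrite Cmod_mult, Cmod_R, Rabs_pos_eq by apply pos_INR.
    field. lra.
Qed.

(** * The power series [f] *)

(** Lets monomials share the growth and Taylor estimates of the Bernoulli polynomials. *)
Lemma pow_appell (n : nat) (z : C) : z ^ n = NtoC (fact n) * appell delta n z.
Proof.
  unfold appell. rewrite conv_delta_l. unfold exp_coef. field.
  apply NtoC_neq_0, lt_O_fact.
Qed.

Lemma delta_bound (k : nat) : (Cmod (delta k) * PI ^ k <= 1)%R.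
Proof.
  rewrite Cmod_delta. destruct k; simpl; lra.
Qed.

Lemma pow_growth (n : nat) (z : C) :
  (Cmod (z ^ n) <= growth n * exp (PI * Cmod z))%R.
Proof.
  rewrite pow_appell. apply Cmod_fact_mult_le.
  rewrite <- (Rmult_1_l (exp _)).
  apply Cmod_appell_le; [exact PI_RGT_0|exact delta_bound].
Qed.

Lemma Cpseries_summable (c : nat -> C) (z : C) :
  growth_summable c -> is_Cpseries c z (Cpseries c z).
Proof.
  intros Hc.
  assert (H := abs_convergent_Cseries _
    (growth_summable_mult c _ _ Hc (fun n => pow_growth n z))).
  apply is_Cpseries_Cpow in H. rewrite (Cpseries_eq _ _ _ H). exact H.
Qed.

(** Termwise differentiation at every [z]. Stated as an equality of functions, so that it can be
    iterated. *)
Lemma C_derive_Cpseries (c : nat -> C) :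
  growth_summable c -> C_derive (Cpseries c) = Cpseries (deriv_coef c).
Proof.
  intros Hc. apply functional_extensionality. intros z.
  apply is_C_derive_unique.
  replace (Cpseries c) with (fun w => Cseries (fun n => c n * w ^ n)).
  2: { apply functional_extensionality. intros w.
       apply Cseries_eq, is_Cpseries_Cpow, Cpseries_summable, Hc. }
  apply (is_derive_growth_series c (fun n w => w ^ n)
    (fun n => NtoC (fact n) * unshift (fun k => appell delta k z) n) z _
    (1 * exp (PI * Cmod z) * exp PI * PI ^ 2) Hc).
  - intros w. eexists. intros n. apply pow_growth.
  - intros n h Hh. rewrite !pow_appell.
    set (d := unshift (fun k => appell delta k z) n).
    replace (NtoC (fact n) * appell delta n (z + h) - NtoC (fact n) * appell delta n z
             - h * (NtoC (fact n) * d))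
      with (NtoC (fact n) * (appell delta n (z + h) - appell delta n z - h * d)) by ring.
    apply Cmod_fact_mult_le.
    apply appell_taylor; [exact PI_RGT_0|exact delta_bound|exact Hh].
  - assert (H := Cpseries_summable _ z (growth_summable_deriv c Hc)).
    apply is_Cpseries_Cpow in H.
    (* The derivative of the constant term is added as an explicit zero, to match the index
       shift. *)
    replace (Cpseries (deriv_coef c) z)
      with (c O * (NtoC (fact 0) * unshift (fun k => appell delta k z) 0)
            + Cpseries (deriv_coef c) z) by (cbn [unshift]; ring).
    apply (is_Cseries_shift
      (fun n => c n * (NtoC (fact n) * unshift (fun k => appell delta k z) n))).
    eapply is_Cseries_ext; [|exact H].
    intros n. unfold shift, deriv_coef. cbn [unshift].
    rewrite Nat.add_1_r, pow_appell.
    rewrite NtoC_fact_S. ring.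
Qed.

(** * The analytic summand *)

(** The point [t = PI] lies inside the disc of radius [2 * PI]; a convergent series has bounded
    terms. *)
Lemma bernoulli_coef_bound :
  exists K, forall k, (Cmod (bernoulli_coef k) * PI ^ k <= K)%R.
Proof.
  assert (Hpi := PI_RGT_0).
  assert (HC : Cmod PI = PI) by (rewrite Cmod_R, Rabs_pos_eq; lra).
  assert (H : abs_convergent (fun n => bernoulli_coef n * RtoC PI ^ n)).
  { apply abs_convergent_bernoulli_coef; [|lra].
    intros E. apply RtoC_inj in E. lra. }
  destruct (maj_by_pos (fun n => Cmod (bernoulli_coef n * RtoC PI ^ n)))
    as (K & _ & HK).
  - exists 0%R. apply is_lim_seq_Reals, ex_series_lim_0, H.
  - exists K. intros k. specialize (HK k).
    rewrite Rabs_pos_eq, Cmod_mult, Cmod_pow, HC in HK by apply Cmod_ge_0. exact HK.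
Qed.

Lemma bernoulli_growth (z : C) :
  exists D, forall n, (Cmod (bernoulli n z) <= growth n * D)%R.
Proof.
  destruct bernoulli_coef_bound as [K HK].
  exists (K * exp (PI * Cmod z))%R. intros n.
  rewrite bernoulli_appell. apply Cmod_fact_mult_le.
  apply Cmod_appell_le; [exact PI_RGT_0|exact HK].
Qed.

Lemma Spoly_appell (n : nat) (z : C) :
  Spoly n z = NtoC (fact n) *
    (appell bernoulli_coef (S n) (z + 1) - appell bernoulli_coef (S n) 1).
Proof.
  unfold Spoly. rewrite !bernoulli_appell, Nat.add_1_r, NtoC_fact_S.
  field. apply NtoC_neq_0. lia.
Qed.

(** [Spoly n] pairs [n!] with an Appell member of index [n + 1], which costs one factor [1 / PI]. *)
Lemma Cmod_fact_mult_S_le (n : nat) (x : C) (D : R) :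
  (Cmod x * PI ^ S n <= D)%R -> (Cmod (NtoC (fact n) * x) <= growth n * (D / PI))%R.
Proof.
  intros H. assert (Hpi := PI_RGT_0). apply Cmod_fact_mult_le.
  apply Rmult_le_reg_r with PI; [lra|].
  replace (D / PI * PI)%R with D by (field; lra).
  simpl in H. lra.
Qed.

Lemma Spoly_growth (z : C) :
  exists D, forall n, (Cmod (Spoly n z) <= growth n * D)%R.
Proof.
  destruct bernoulli_coef_bound as [K HK].
  exists ((K * exp (PI * Cmod (z + 1)) + K * exp (PI * Cmod 1)) / PI)%R. intros n.
  rewrite Spoly_appell. apply Cmod_fact_mult_S_le.
  assert (H := Cmod_appell_le _ PI K (S n) (z + 1) PI_RGT_0 HK).
  assert (H' := Cmod_appell_le _ PI K (S n) 1 PI_RGT_0 HK).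
  assert (Hp := pow_lt PI (S n) PI_RGT_0).
  eapply Rle_trans.
  - apply Rmult_le_compat_r; [lra|apply Cmod_triangle].
  - rewrite Cmod_opp. lra.
Qed.

(** The constant [B_(n+1)(1)] cancels in the increment, leaving [appell_taylor] at index [n + 1] and
    base point [z + 1]. *)
Lemma Spoly_taylor (z : C) :
  exists D, forall n h, (Cmod h <= 1)%R ->
    (Cmod (Spoly n (z + h) - Spoly n z - h * bernoulli n (z + 1))
     <= growth n * (D * Cmod h ^ 2))%R.
Proof.
  destruct bernoulli_coef_bound as [K HK].
  exists (K * exp (PI * Cmod (z + 1)) * exp PI * PI ^ 2 / PI)%R. intros n h Hh.
  rewrite !Spoly_appell, bernoulli_appell.
  set (A := appell bernoulli_coef).
  replace (z + h + 1) with (z + 1 + h) by ring.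
  replace (NtoC (fact n) * (A (S n) (z + 1 + h) - A (S n) 1)
           - NtoC (fact n) * (A (S n) (z + 1) - A (S n) 1)
           - h * (NtoC (fact n) * A n (z + 1)))
    with (NtoC (fact n) * (A (S n) (z + 1 + h) - A (S n) (z + 1) - h * A n (z + 1)))
    by ring.
  replace (K * exp (PI * Cmod (z + 1)) * exp PI * PI ^ 2 / PI * Cmod h ^ 2)%R
    with (K * exp (PI * Cmod (z + 1)) * exp PI * PI ^ 2 * Cmod h ^ 2 / PI)%R
    by (unfold Rdiv; ring).
  apply Cmod_fact_mult_S_le.
  exact (appell_taylor bernoulli_coef PI K (S n) (z + 1) h PI_RGT_0 HK Hh).
Qed.

Lemma is_derive_Spoly (n : nat) (z : C) :
  @is_derive C_AbsRing C_NormedModule (Spoly n) z (bernoulli n (z + 1)).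
Proof.
  destruct (Spoly_taylor z) as [D HD].
  apply is_derive_quadratic with (growth n * D)%R.
  intros h Hh. rewrite Rmult_assoc. apply HD, Hh.
Qed.

Lemma Spoly_summable (c : nat -> C) (z : C) :
  growth_summable c -> abs_convergent (fun n => c n * Spoly n z).
Proof.
  intros Hc. destruct (Spoly_growth z) as [D HD].
  exact (growth_summable_mult c _ D Hc HD).
Qed.

Lemma bernoulli_summable (c : nat -> C) (z : C) :
  growth_summable c -> abs_convergent (fun n => c n * bernoulli n z).
Proof.
  intros Hc. destruct (bernoulli_growth z) as [D HD].
  exact (growth_summable_mult c _ D Hc HD).
Qed.

(** The coefficients in [is_summand] are existential; uniqueness of power series around 0 forces
    them to be [c]. *)
Lemma is_summand_Cpseries (c : nat -> C) (z s : C) :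
  growth_summable c ->
  is_summand (Cpseries c) z s <-> is_Cseries (fun n => c n * Spoly n z) s.
Proof.
  intros Hc. split.
  - intros (a & [eps Heps] & Hs).
    assert (E : forall n, a n = c n).
    { apply (Cpseries_coef_unique a c eps (cond_pos eps)). intros t Ht Htr.
      exists (Cpseries c t). split.
      - apply Heps. split.
        + change (Rabs (t - 0) < eps)%R. rewrite Rminus_0_r. exact Htr.
        + change (Rabs (0 - 0) < eps)%R. rewrite Rminus_0_r, Rabs_R0. apply cond_pos.
      - apply Cpseries_summable, Hc. }
    revert Hs. apply is_Cseries_ext. intros n. rewrite E. reflexivity.
  - intros Hs. exists c. split; [|exact Hs].
    exists (mkposreal 1 Rlt_0_1). intros w _. apply Cpseries_summable, Hc.
Qed.

Lemma summand_Cpseries (c : nat -> C) (z : C) :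
  growth_summable c ->
  summand (Cpseries c) z = Cseries (fun n => c n * Spoly n z).
Proof.
  intros Hc. apply (iota_unique (V := C_CompleteNormedModule)).
  - intros y Hy. apply is_summand_Cpseries in Hy; [|exact Hc].
    symmetry. apply Cseries_eq, Hy.
  - apply is_summand_Cpseries; [exact Hc|].
    apply abs_convergent_Cseries, Spoly_summable, Hc.
Qed.

Lemma is_derive_summand (c : nat -> C) (z : C) :
  growth_summable c ->
  @is_derive C_AbsRing C_NormedModule (summand (Cpseries c)) z
    (Cseries (fun n => c n * bernoulli n (z + 1))).
Proof.
  intros Hc.
  replace (summand (Cpseries c)) with (fun w => Cseries (fun n => c n * Spoly n w))
    by (apply functional_extensionality; intros w; symmetry;
        apply summand_Cpseries, Hc).
  destruct (Spoly_taylor z) as [D HD].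
  apply (is_derive_growth_series c Spoly (fun n => bernoulli n (z + 1)) z _ D Hc
    Spoly_growth HD).
  apply abs_convergent_Cseries, bernoulli_summable, Hc.
Qed.

Lemma is_sigma_prime_iff (c : nat -> C) (z l : C) :
  is_sigma_prime c z l <-> is_Cseries (fun n => c n * bernoulli n (z + 1)) l.
Proof.
  assert (E : (fun n => c n * C_derive (Spoly n) z)
              = (fun n => c n * bernoulli n (z + 1))).
  { apply functional_extensionality. intros n.
    rewrite (is_C_derive_unique _ _ _ (is_derive_Spoly n z)). reflexivity. }
  unfold is_sigma_prime. rewrite E. split.
  - intros [_ H]. exact H.
  - intros H. split; [|exact H].
    intros n. eexists. apply is_derive_Spoly.
Qed.

Lemma sigma_prime_eq (c : nat -> C) (z : C) :
  growth_summable c ->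
  sigma_prime c z = Cseries (fun n => c n * bernoulli n (z + 1)).
Proof.
  intros Hc. apply (iota_unique (V := C_CompleteNormedModule)).
  - intros y Hy. apply is_sigma_prime_iff in Hy. symmetry. apply Cseries_eq, Hy.
  - apply is_sigma_prime_iff, abs_convergent_Cseries, bernoulli_summable, Hc.
Qed.

Lemma bernoulli_0 (z : C) : bernoulli 0 z = 1.
Proof.
  rewrite bernoulli_appell. unfold appell. cbn [conv bernoulli_coef].
  rewrite exp_coef_0. unfold NtoC. cbn. ring.
Qed.

(** By definition [(n + 1) S_n(z) = B_(n+1)(z + 1) - B_(n+1)(1)], so the first series on the right
    sums the differences of the other two termwise. *)
Lemma Cseries_bernoulli_split (c : nat -> C) (z : C) :
  growth_summable c ->
  Cseries (fun n => c n * bernoulli n (z + 1))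
  = Cseries (fun n => deriv_coef c n * Spoly n z)
    + Cseries (fun n => c n * bernoulli n (0 + 1)).
Proof.
  intros Hc. apply Cseries_eq.
  set (s := Cseries (fun n => deriv_coef c n * Spoly n z)).
  set (t := Cseries (fun n => c n * bernoulli n (0 + 1))).
  set (d := fun n => c n * bernoulli n (z + 1) + (-1) * (c n * bernoulli n (0 + 1))).
  assert (Hs : is_Cseries d s).
  (* The difference at index 0 vanishes because [B_0 = 1]. *)
  { replace s with (d O + s) by (unfold d; rewrite !bernoulli_0; ring).
    apply is_Cseries_shift.
    eapply is_Cseries_ext;
      [|apply abs_convergent_Cseries, Spoly_summable, growth_summable_deriv, Hc].
    intros n. unfold shift, d, deriv_coef, Spoly.
    rewrite Cplus_0_l, Nat.add_1_r. field. apply NtoC_neq_0. lia. }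
  assert (Ht : is_Cseries (fun n => c n * bernoulli n (0 + 1)) t)
    by (apply abs_convergent_Cseries, bernoulli_summable, Hc).
  eapply is_Cseries_ext; [|exact (is_Cseries_plus _ _ _ _ Hs Ht)].
  intros n. unfold d. ring.
Qed.

Theorem corollary3p2 (c : nat -> C) (f : C -> C)
    (Hf : f = Cpseries c)
    (Hc : abs_convergent (fun n => NtoC (fact n) / (RtoC PI ^ n) * c n)) :
  (* (a) *)
  (forall z : C,
     abs_convergent (fun n => c (n + 1)%nat * bernoulli (n + 1) (z + 1)) /\
     abs_convergent (fun n => NtoC (n + 1) * c (n + 1)%nat * Spoly n z)) /\
  (* (b) *)
  (forall (m : nat) (z : C), exists s : C, is_summand (Cderive_n m f) z s) /\
  (forall z : C, exists l : C, is_sigma_prime c z l) /\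
  (* identities *)
  (forall z : C,
     Cholo_at (summand f) z /\
     Cseries (fun n => c n * bernoulli n (z + 1)) = C_derive (summand f) z /\
     C_derive (summand f) z = sigma_prime c z /\
     sigma_prime c z = summand (C_derive f) z + sigma_prime c 0 /\
     summand (C_derive f) z + sigma_prime c 0 =
       Cseries (fun n => NtoC (n + 1) * c (n + 1)%nat * Spoly n z)
         + sigma_prime c 0).
Proof.
  subst f. change (growth_summable c) in Hc.
  assert (Hc' := growth_summable_deriv c Hc).
  split; [|split; [|split]].
  - intros z. split; [|exact (Spoly_summable _ z Hc')].
    apply (ex_series_ext (fun n => Cmod (c (S n) * bernoulli (S n) (z + 1)))).
    + intros n. rewrite Nat.add_1_r. reflexivity.
    + apply (ex_series_incr_1 (K := R_AbsRing) (V := R_NormedModule)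
        (fun n => Cmod (c n * bernoulli n (z + 1)))).
      apply bernoulli_summable, Hc.
  - intros m z.
    (* Weighted summability survives each differentiation, so every derivative is again a power
       series of the same kind. *)
    assert (H : exists a, growth_summable a /\ Cderive_n m (Cpseries c) = Cpseries a).
    { induction m as [|m (a & Ha & E)].
      - exists c. split; [exact Hc|reflexivity].
      - exists (deriv_coef a). split; [apply growth_summable_deriv, Ha|].
        change (C_derive (Cderive_n m (Cpseries c)) = Cpseries (deriv_coef a)).
        rewrite E. apply C_derive_Cpseries, Ha. }
    destruct H as (a & Ha & ->).
    exists (Cseries (fun n => a n * Spoly n z)).
    apply is_summand_Cpseries; [exact Ha|].
    apply abs_convergent_Cseries, Spoly_summable, Ha.
  - intros z. exists (Cseries (fun n => c n * bernoulli n (z + 1))).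
    apply is_sigma_prime_iff, abs_convergent_Cseries, bernoulli_summable, Hc.
  - intros z. assert (Hd := is_derive_summand c z Hc).
    rewrite (is_C_derive_unique _ _ _ Hd), !sigma_prime_eq by exact Hc.
    rewrite C_derive_Cpseries, summand_Cpseries by assumption.
    split; [eexists; exact Hd|].
    repeat split. apply Cseries_bernoulli_split, Hc.
Qed.
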